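(* Let $k=k_{\mathcal X}\otimes k_{\mathcal Y}$ be $\mathfrak S_{\mathcal Z}$-measurable with $|k|\le 1$, where $k_{\mathcal X}$ and $k_{\mathcal Y}$ are continuous kernels on $\mathcal X$ and $\mathcal Y$ with $|k_{\mathcal X}|\le1$, $|k_{\mathcal Y}|\le 1$. Assume that for every $\theta\in\Theta$ there exists a bounded linear conditional mean embedding operator $\mathcal C_\theta:\mathcal H_{\mathcal X}\to\mathcal H_{\mathcal Y}$ for $(P_{g(\theta,x)})_{x\in\mathcal X}$ and that $\mathfrak C:=\sup_{\theta\in\Theta}\|\mathcal C_\theta\|_{\mathrm o}<\infty$. Let $\Theta\subseteq\mathbb R^p$ with Euclidean norm $\|\cdot\|$, and let the pairs $(X_i^0,Y_i^0)$, $i\ge1$, be i.i.d. from a probability distribution $P^0$ on $\mathcal Z$. Assume that there is a unique $\theta_0\in\Theta$ such that $\mathbb D_k(P_{\theta_0},P^0)=\inf_{\theta\in\Theta}\mathbb D_k(P_\theta,P^0)$, and that there exist a neighbourhood $U$ of $\theta_0$ and a constant $\mu>0$ such that $$\mathbb D_k(P_\theta,P^0)\ge\mathbb D_k(P_{\theta_0},P^0)+\mu\|\theta-\theta_0\|,\qquad\forall\theta\in U.$$ Let $\alpha=\inf_{\theta\in U^c}\mathbb D_k(P_\theta,P^0)-\mathbb D_k(P_{\theta_0},P^0)$, with $\alpha\in(0,2]$, and assume that, for some $\epsilon\in[0,\alpha/64)$, for every $n$ the dataset $D_n=\{(X_i,Y_i)\}_{i=1}^n$ is an $\epsilon$-adversarial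 contamination of $D_n^0=\{(X_i^0,Y_i^0)\}_{i=1}^n$. Let $\hat\theta_n$ be the MMD estimator computed from $D_n$. Then $$\mathbb P\Big(\limsup_{n\to\infty}\|\hat\theta_n-\theta_0\|\le 8\epsilon/\mu\Big)=1,$$ and there exist constants $C_1,C_2\in(0,\infty)$, depending only on $\alpha$ and $\mathfrak C$, such that for all $n\ge C_1$ and all $\eta\in[8e^{-C_2n},1)$, $$\mathbb P\Big[\|\hat\theta_n-\theta_0\|<\frac{8\epsilon}{\mu}+n^{-1/2}(\mathfrak C+3)\,\frac{1+\sqrt{2\log(8/\eta)}}{\mu}\Big]\ge1-\eta.$$
   Context: $\mathcal X,\mathcal Y$ are topological spaces with Borel $\sigma$-algebras $\mathfrak S_{\mathcal X},\mathfrak S_{\mathcal Y}$; $\mathcal Z=\mathcal X\times\mathcal Y$, $\mathfrak S_{\mathcal Z}=\mathfrak S_{\mathcal X}\otimes\mathfrak S_{\mathcal Y}$. A kernel is a symmetric positive definite function; $\mathcal H,\mathcal H_{\mathcal X},\mathcal H_{\mathcal Y}$ are the RKHSs of $k,k_{\mathcal X},k_{\mathcal Y}$; $(k_{\mathcal X}\otimes k_{\mathcal Y})\{(x,y),(x',y')\}=k_{\mathcal X}(x,x')k_{\mathcal Y}(y,y')$. For probability distributions $P,Q$ on $\mathcal Z$, $\mathbb D_k(P,Q)=\|\mu(P)-\mu(Q)\|_{\mathcal H}$ with $\mu(P)=\mathbb E_{Z\sim P}[k(Z,\cdot)]$. All random variables live on one probability space $(\Omega,\mathcal F,\mathbb P)$.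 Model: $\{P_\lambda,\lambda\in\Lambda\}$ is a set of probability distributions on $\mathcal Y$, $\Theta$ is a Polish space, and $g:\Theta\times\mathcal X\to\Lambda$ is such that $x\mapsto P_{g(\theta,x)}(A)$ is measurable for all $A\in\mathfrak S_{\mathcal Y}$, $\theta\in\Theta$. With $P^0_X$ the $\mathcal X$-marginal of $P^0$, $P_\theta(A\times B)=\mathbb E_{X\sim P_X^0}\{\mathbf 1_A(X)P_{g(\theta,X)}(B)\}$. A conditional mean embedding operator of $(P_{g(\theta,x)})_{x\in\mathcal X}$ is a mapping $\mathcal C_\theta:\mathcal H_{\mathcal X}\to\mathcal H_{\mathcal Y}$ with $\mathcal C_\theta k_{\mathcal X}(x,\cdot)=\mathbb E_{Y\sim P_{g(\theta,x)}}[k_{\mathcal Y}(Y,\cdot)]$ for all $x\in\mathcal X$; $\|\cdot\|_{\mathrm o}$ is the operator norm. Estimator: with $\hat P^n=\frac1n\sum_{i=1}^n\delta_{(X_i,Y_i)}$ and $\hat P^n_\theta(A\times B)=\frac1n\sum_{i=1}^n\delta_{X_i}(A)P_{g(\theta,X_i)}(B)$, $\hat\theta_n\in\operatorname{argmin}_{\theta\in\Theta}\mathbb D_k^2(\hat P^n_\theta,\hat P^n)$, a minimizer assumed to exist and to be measurable. $\epsilon$-adversarial contamination: there is a set $I\subset\{1,\dots,n\}$ with $|I|/n\le\epsilon$ and $(X_i,Y_i)=(X_i^0,Y_i^0)$ for all $i\notin I$. *)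

(* Defs.v *)
From HB Require Import structures.
From mathcomp Require Import all_boot all_order all_algebra.
From mathcomp Require Import finmap.
From mathcomp Require Import all_classical all_reals all_analysis.
From mathcomp Require Import measurable_realfun sesquilinear.

Set Implicit Arguments.
Unset Strict Implicit.
Unset Printing Implicit Defensive.
Import Order.TTheory GRing.Theory Num.Theory.
Import numFieldNormedType.Exports.
Local Open Scope classical_set_scope.
Local Open Scope ring_scope.

(* [T] with its Borel sigma-algebra; on [borel X * borel Y] the library puts
   the product sigma-algebra, which may be smaller than the Borel one. *)
Notation borel T := (g_sigma_algebraType (@open T)).

Definition borel_measurable d (W : measurableType d) (T : topologicalType)
    (f : W -> T) : Prop :=
  forall A : set T, <<s @open T >> A -> measurable (f @^-1` A).

(* [T] is separable, and its topology is that of a complete metric. *)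
Definition polish (R : realType) (T : topologicalType) : Prop :=
  (exists2 D : set T, countable D & dense D) /\
  exists dist : T -> T -> R,
    [/\ (forall x y, dist x y = 0 <-> x = y),
        (forall x y, dist x y = dist y x),
        (forall x y z, dist x z <= dist x y + dist y z),
        (forall x (A : set T), nbhs x A <->
           exists2 r : R, 0 < r & [set y | dist x y < r] `<=` A)
      & (forall u : nat -> T,
           (forall r : R, 0 < r -> exists N : nat, forall m n : nat,
              (N <= m)%N -> (N <= n)%N -> dist (u m) (u n) < r) ->
           exists l : T, u @ \oo --> l)].

Definition euclidean_norm (R : realType) (p : nat) (v : 'rV[R]_p) : R :=
  Num.sqrt (\sum_(i < p) v 0 i ^+ 2).

Definition is_kernel (R : realType) (T : Type) (k : T -> T -> R) : Prop :=
  (forall x y, k x y = k y x) /\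
  (forall (m : nat) (x : 'I_m -> T) (a : 'I_m -> R),
     0 <= \sum_(i < m) \sum_(j < m) a i * a j * k (x i) (x j)).

Definition tensor_kernel (R : realType) (X Y : Type)
    (kX : X -> X -> R) (kY : Y -> Y -> R) (z z' : X * Y) : R :=
  kX z.1 z'.1 * kY z.2 z'.2.

(* The reproducing kernel Hilbert space of [k], which is unique up to a unique
   isometry respecting evaluation. Its elements are functions on [T]:
   [rkhs_eval] is the injective map from an element to the function it is, and
   [feature x] is the element k(x, .). *)
Record rkhs (R : realType) (T : Type) (k : T -> T -> R) := Rkhs {
  rkhs_space :> completeNormedModType R ;
  inner : {dot rkhs_space for @idfun R} ;
  norm_inner : forall f : rkhs_space, `|f| ^+ 2 = inner f f ;
  rkhs_eval : rkhs_space -> T -> R ;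
  rkhs_eval_linear : forall (a : R) (f g : rkhs_space) (x : T),
    rkhs_eval (a *: f + g) x = a * rkhs_eval f x + rkhs_eval g x ;
  rkhs_eval_inj : injective rkhs_eval ;
  feature : T -> rkhs_space ;
  feature_eval : forall x y, rkhs_eval (feature x) y = k x y ;
  reproducing : forall (f : rkhs_space) (x : T),
    inner f (feature x) = rkhs_eval f x }.

Section mean_embedding.
Context (R : realType) (d : measure_display) (T : measurableType d).
Context (k : T -> T -> R) (H : rkhs k).

(* Expectation of an H-valued random element, in the weak sense:
   <f, E V> = E <f, V> for all f. *)
Definition is_expectation (P : {measure set T -> \bar R}) (V : T -> H)
    (m : H) : Prop :=
  forall f : H, P.-integrable setT (fun t => (inner H f (V t))%:E) /\
    inner H f m = \int[P]_t inner H f (V t).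

(* The expectation of V when it exists, in which case it is unique. *)
Definition expectation_in (P : {measure set T -> \bar R}) (V : T -> H) : H :=
  get [set m | is_expectation P V m].

Definition mean_embedding (P : {measure set T -> \bar R}) : H :=
  expectation_in P (feature H).

Definition mmd (P Q : {measure set T -> \bar R}) : R :=
  `|mean_embedding P - mean_embedding Q|.

End mean_embedding.

Definition op_norm (R : realType) (V W : normedModType R) (C : V -> W)
  : \bar R := ereal_sup [set `|C f|%:E | f in [set f : V | `|f| <= 1]].

Definition is_cme (R : realType) (X : Type) (d : measure_display)
    (Y : measurableType d) (kX : X -> X -> R) (kY : Y -> Y -> R)
    (HX : rkhs kX) (HY : rkhs kY) (Q : X -> probability Y R)
    (C : HX -> HY) : Prop :=
  forall x : X, C (feature HX x) = mean_embedding HY (Q x).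

HB.instance Definition _ (d1 d2 : measure_display) (X : measurableType d1)
    (Y : measurableType d2) :=
  isMeasurableFun.Build _ _ (X * Y)%type X fst measurable_fst.

Section joint.
Context (R : realType) (d1 d2 : measure_display).
Context (X : measurableType d1) (Y : measurableType d2).
Context (PX : probability X R) (Q : X -> probability Y R).
Context (mQ : forall A : set Y, measurable A ->
  measurable_fun [set: X] (fun x => Q x A)).
Local Open Scope ereal_scope.

(* The law of (x, y) for x ~ PX and y ~ Q x given x; the measurability of Q is
   an argument so that the result can be a [probability]. *)
Definition joint of (forall A : set Y, measurable A ->
    measurable_fun [set: X] (fun x => Q x A)) :=
  fun S : set (X * Y) => \int[PX]_x Q x (xsection S x).

Let Qm (x : X) : {measure set Y -> \bar R} := Q x.
HB.instance Definition _ := isKernel.Build _ _ _ _ _ Qm mQ.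
Let Qm1 : forall x, Qm x setT = 1. Proof. by move=> x; exact: probability_setT. Qed.
HB.instance Definition _ := Kernel_isProbability.Build _ _ _ _ _ Qm Qm1.

Let mQx (S : set (X * Y)) : measurable S ->
  measurable_fun [set: X] (fun x => Q x (xsection S x)).
Proof.
by move=> mS; apply: (@measurable_fun_xsection_finite_kernel _ _ _ _ _ Qm);
  rewrite inE.
Qed.

Let joint0 : joint mQ set0 = 0.
Proof.
by rewrite /joint; apply: integral0_eq => x _; rewrite xsection0 measure0.
Qed.

Let joint_ge0 S : 0 <= joint mQ S.
Proof. by apply: integral_ge0 => x _; exact: measure_ge0. Qed.

Let joint_sigma_additive : semi_sigma_additive (joint mQ).
Proof.
move=> F mF tF mUF.
have -> : joint mQ (\bigcup_n F n) = \sum_(0 <= i <oo) joint mQ (F i).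
  rewrite /joint -integral_nneseries//; last by move=> n; exact: mQx.
  apply: eq_integral => x _; rewrite xsection_bigcup.
  apply/esym/cvg_lim => //; apply: measure_semi_sigma_additive.
  - by move=> n; exact: measurable_xsection.
  - exact: trivIset_xsection.
  - by apply: bigcup_measurable => n _; exact: measurable_xsection.
by apply: is_cvg_nneseries => n _ _; exact: joint_ge0.
Qed.

HB.instance Definition _ := isMeasure.Build _ _ _ (joint mQ)
  joint0 joint_ge0 joint_sigma_additive.

Let joint_setT : joint mQ setT = 1.
Proof.
rewrite /joint (eq_integral (cst 1)); last first.
  move=> x _; rewrite (_ : xsection _ _ = setT) ?probability_setT//.
  by apply/seteqP; split => // y _; rewrite /xsection /= in_setT.
by rewrite integral_cst// mul1e; exact: probability_setT.
Qed.

HB.instance Definition _ := Measure_isProbability.Build _ _ _ (joint mQ)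
  joint_setT.

Lemma joint_rectangle (A : set X) (B : set Y) :
  joint mQ (A `*` B) = \int[PX]_x ((\1_A x)%:E * Q x B).
Proof.
apply: eq_integral => x _; rewrite indicE.
have [xA|xA] := boolP (x \in A); first by rewrite in_xsectionX// mul1e.
by rewrite notin_xsectionX// measure0 mul0e.
Qed.

End joint.

(* The average of m 0, ..., m (n - 1). *)
Definition average_measure (R : realType) (d : measure_display)
    (T : measurableType d) (n : nat) (m : nat -> {measure set T -> \bar R})
  : {measure set T -> \bar R} := mscale (n%:R^-1)%:nng (msum m n).

Definition empirical (R : realType) (d : measure_display)
    (T : measurableType d) (n : nat) (z : nat -> T)
  : {measure set T -> \bar R} :=
  average_measure n (fun i => \d_(z i)).

Definition empirical_model (R : realType) (d1 d2 : measure_display)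
    (X : measurableType d1) (Y : measurableType d2)
    (Q : X -> probability Y R) (n : nat) (x : nat -> X)
  : {measure set (X * Y) -> \bar R} :=
  average_measure n (fun i => \d_(x i) \x Q (x i))%E.

Definition is_argmin (R : realType) (T : Type) (F : T -> R) (t : T) : Prop :=
  forall s : T, F t <= F s.

Definition mutually_independent (R : realType) (d d' : measure_display)
    (W : measurableType d) (Z : measurableType d') (Pr : probability W R)
    (V : nat -> W -> Z) : Prop :=
  forall (J : {fset nat}) (A : nat -> set Z), (forall i, measurable (A i)) ->
    Pr (\bigcap_(i in [set` J]) (V i @^-1` A i)) =
    (\prod_(i <- J) Pr (V i @^-1` A i))%E.

Definition iid_from (R : realType) (d d' : measure_display)
    (W : measurableType d) (Z : measurableType d') (Pr : probability W R)
    (P : probability Z R) (V : nat -> W -> Z) : Prop :=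
  [/\ (forall i, measurable_fun setT (V i)),
      (forall i (A : set Z), measurable A -> Pr (V i @^-1` A) = P A)
    & mutually_independent Pr V].

(* [z] and [z0] are data sets of size n, indexed from 0. *)
Definition adversarial_contamination (R : realType) (Z : Type) (eps : R)
    (n : nat) (z z0 : nat -> Z) : Prop :=
  exists2 I : {set 'I_n}, #|I|%:R / n%:R <= eps &
    forall i : 'I_n, i \notin I -> z i = z0 i.

(* Main.v *)
(* Write mu for the mean embedding in H and D(theta) for the criterion. A chain of
   triangle inequalities through the empirical measures bounds the excess
   D(thetahat) - D(theta0) by 8 eps, the cost of the contamination, plus
   frakC A + E + 2 B, all computed on the clean sample: B is the distance in H from
   its empirical measure to P0, E the distance from the mean of
   phi(x) = mu(delta_x (x) P_(g(theta0, x))) over the sample to its expectation,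
   and A the distance of the X-marginals for the kernel kX^2. The last one
   controls the random thetahat: <phi_theta x, phi_theta x'> equals
   kX(x, x') <C_theta k_x, C_theta k_x'>, so by the Schur product theorem
   frakC^2 kX^2 minus this kernel is again a kernel, uniformly in theta. Each of A,
   E, B exceeds (1 + t) / sqrt n with probability at most exp (- t^2 / 2). An excess
   below alpha puts thetahat in U, where the excess is at least
   mu |thetahat - theta0|. The first claim then follows by Borel-Cantelli.

   The concentration bound is proved for measurable positive definite kernels and
   not for Hilbert-valued variables: no Hilbert space for kX^2 has to be built, and
   the given ones need not be separable. *)

(* The estimator depends on the whole sample, so no concentration bound applies to its own term
   directly; the domination of kernels trades that term for one without [theta], and the three
   exceptional events do not involve [thetahat]. The 8 in 8 eps counts four passages between the
   given data and the clean sample: an average of n vectors of norm at most 1 moves by at most 2 / n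
   per altered point, hence by 2 eps in each passage. In (1 + t) / sqrt n the 1 comes from the
   second moment of a centred feature, which is at most 1, and the t from Hoeffding's lemma for a
   variable of oscillation at most 2. The thresholds C1 and C2 make these two parts contribute at
   most alpha / 4 each to the excess; since 8 eps < alpha / 8, the excess stays below alpha.
   Measurability of kX and kY for the product sigma-algebras is extracted from that of k, as those
   sigma-algebras may be smaller than the Borel ones of the product spaces. *)
Require Import Defs.
From HB Require Import structures.
From mathcomp Require Import all_boot all_order all_algebra.
From mathcomp Require Import finmap ring lra.
From mathcomp Require Import all_classical all_reals all_analysis.
From mathcomp Require Import measurable_realfun sesquilinear.

Set Implicit Arguments.
Unset Strict Implicit.
Unset Printing Implicit Defensive.
Import Order.TTheory GRing.Theory Num.Theory.
Import numFieldNormedType.Exports.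
Local Open Scope classical_set_scope.
Local Open Scope ring_scope.

(** * Bounded measurable functions *)

(* [probability_setT] for a probability coerced to a measure: rewriting with
   [probability_setT] itself does not see through the coercion. *)
Lemma probability_measure_setT (R : realType) d (T : measurableType d)
    (P : probability T R) : (P : {measure set T -> \bar R}) setT = 1%E.
Proof. exact: probability_setT. Qed.

Section bounded_measurable.
Context (R : realType) (d : measure_display) (T : measurableType d).
Implicit Types f g : T -> R.

(** This class is closed under the operations used below and its members are integrable for every
    probability, so all integrability conditions reduce to membership. *)
Definition bmeas f : Prop :=
  measurable_fun setT f /\ exists M, forall x, `|f x| <= M.

Lemma bmeas_cst (c : R) : bmeas (fun=> c).
Proof. by split; [exact: measurable_cst|exists `|c|]. Qed.

Lemma bmeasD f g : bmeas f -> bmeas g -> bmeas (fun x => f x + g x).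
Proof.
move=> [mf [M fM]] [mg [N gN]]; split; first exact: measurable_funD.
by exists (M + N) => x; apply: le_trans (ler_normD _ _) _; exact: lerD.
Qed.

Lemma bmeasM f g : bmeas f -> bmeas g -> bmeas (fun x => f x * g x).
Proof.
move=> [mf [M fM]] [mg [N gN]]; split; first exact: measurable_funM.
by exists (M * N) => x; rewrite normrM ler_pM.
Qed.

Lemma bmeasZ c f : bmeas f -> bmeas (fun x => c * f x).
Proof. exact/bmeasM/bmeas_cst. Qed.

Lemma bmeasN f : bmeas f -> bmeas (fun x => - f x).
Proof.
move=> bf; rewrite (_ : (fun x => _) = (fun x => -1 * f x)); first exact: bmeasZ.
by apply/funext => x; rewrite mulN1r.
Qed.

Lemma bmeasB f g : bmeas f -> bmeas g -> bmeas (fun x => f x - g x).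
Proof. by move=> bf bg; apply: bmeasD => //; exact: bmeasN. Qed.

Lemma bmeas_sum (I : Type) (s : seq I) (F : I -> T -> R) :
  (forall i, bmeas (F i)) -> bmeas (fun x => \sum_(i <- s) F i x).
Proof.
move=> bF; elim: s => [|i s IHs].
  by under eq_fun do rewrite big_nil; exact: bmeas_cst.
by under eq_fun do rewrite big_cons; exact: bmeasD.
Qed.

Lemma bmeas_comp (h : R -> R) f : continuous h -> bmeas f -> bmeas (h \o f).
Proof.
move=> hc [mf [M fM]]; split.
  by apply: measurableT_comp => //; exact: continuous_measurable_fun.
have M0 : - `|M| <= `|M| by rewrite ge0_cp.
have hcw : {within `[- `|M|, `|M|], continuous h} by exact: continuous_subspaceT.
have [a _ ha] := EVT_max M0 hcw; have [b _ hb] := EVT_min M0 hcw.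
exists (`|h a| + `|h b|) => x.
have xM : f x \in `[- `|M|, `|M|].
  by rewrite in_itv/= -ler_norml; exact: le_trans (fM x) (ler_norm _).
rewrite ler_norml; apply/andP; split.
- rewrite (le_trans _ (hb _ xM))// lerNl (le_trans (ler_norm _))// normrN.
  by rewrite lerDr.
- by rewrite (le_trans (ha _ xM))// (le_trans (ler_norm _))// lerDl.
Qed.

Lemma bmeas_integrable (P : probability T R) f :
  bmeas f -> P.-integrable setT (EFin \o f).
Proof.
move=> [mf [M fM]]; apply: measurable_bounded_integrable => //.
  by rewrite [ltLHS]probability_setT ltry.
exists M; split; first exact: num_real.
by move=> N MN x _; exact: le_trans (fM x) (ltW MN).
Qed.

Variable P : probability T R.

Lemma EFin_Rint f : bmeas f -> (\int[P]_x f x)%:E = (\int[P]_x (f x)%:E)%E.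
Proof.
move=> bf; rewrite fineK//; apply: integrable_fin_num => //.
exact: bmeas_integrable.
Qed.

Lemma RintD f g : bmeas f -> bmeas g ->
  \int[P]_x (f x + g x) = \int[P]_x f x + \int[P]_x g x.
Proof. by move=> bf bg; rewrite RintegralD//; exact: bmeas_integrable. Qed.

Lemma RintZ c f : bmeas f -> \int[P]_x (c * f x) = c * \int[P]_x f x.
Proof. by move=> bf; rewrite RintegralZl//; exact: bmeas_integrable. Qed.

Lemma Rint_cst (c : R) : \int[P]_x c = c.
Proof. by rewrite Rintegral_cst// probability_measure_setT mulr1. Qed.

Lemma RintN f : bmeas f -> \int[P]_x (- f x) = - \int[P]_x f x.
Proof.
move=> bf; under eq_Rintegral do rewrite -mulN1r.
by rewrite RintZ// mulN1r.
Qed.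

Lemma RintB f g : bmeas f -> bmeas g ->
  \int[P]_x (f x - g x) = \int[P]_x f x - \int[P]_x g x.
Proof. by move=> bf bg; rewrite RintD ?RintN//; exact: bmeasN. Qed.

Lemma Rint_sum (I : Type) (s : seq I) (F : I -> T -> R) :
  (forall i, bmeas (F i)) ->
  \int[P]_x (\sum_(i <- s) F i x) = \sum_(i <- s) \int[P]_x F i x.
Proof.
move=> bF; elim: s => [|i s IHs].
  by under eq_Rintegral do rewrite big_nil; rewrite Rint_cst big_nil.
under eq_Rintegral do rewrite big_cons.
by rewrite RintD ?IHs ?big_cons//; exact: bmeas_sum.
Qed.

Lemma Rint_le f g : bmeas f -> bmeas g -> (forall x, f x <= g x) ->
  \int[P]_x f x <= \int[P]_x g x.
Proof. by move=> bf bg fg; apply: le_Rintegral => //; exact: bmeas_integrable. Qed.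

Lemma Rint_norm_le f M : bmeas f -> (forall x, `|f x| <= M) ->
  `|\int[P]_x f x| <= M.
Proof.
move=> bf fM; rewrite ler_norml; apply/andP; split.
- rewrite -[leLHS]Rint_cst; apply: Rint_le => // [|x]; first exact: bmeas_cst.
  by have := fM x; rewrite ler_norml => /andP[].
- rewrite -[leRHS]Rint_cst; apply: Rint_le => // [|x]; first exact: bmeas_cst.
  by have := fM x; rewrite ler_norml => /andP[].
Qed.

(** The variance of [f] is nonnegative; this is the case of Jensen's inequality used in the
    concentration step. *)
Lemma sqr_Rint_le f : bmeas f -> (\int[P]_x f x) ^+ 2 <= \int[P]_x (f x ^+ 2).
Proof.
move=> bf; set m := \int[P]_x f x.
have : 0 <= \int[P]_x ((f x - m) ^+ 2).
  by apply: Rintegral_ge0 => x _; exact: sqr_ge0.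
have -> : \int[P]_x ((f x - m) ^+ 2) =
    \int[P]_x (f x * f x + (- (2 * m)) * f x + m ^+ 2).
  by apply: eq_Rintegral => x _; ring.
have bff := bmeasM bf bf; have bmf := bmeasZ (- (2 * m)) bf.
rewrite !RintD ?RintZ ?Rint_cst//; [|exact: bmeas_cst|exact: bmeasD|exact: bmeas_cst].
rewrite -/m => h; rewrite -subr_ge0.
have -> : \int[P]_x (f x ^+ 2) = \int[P]_x (f x * f x).
  by apply: eq_Rintegral => x _.
by move: h; congr (_ <= _); ring.
Qed.

End bounded_measurable.

(** * Hoeffding's lemma *)

Section hoeffding.
Context (R : realType).
Implicit Types m s u : R.

Lemma is_derive_ge0_le (f df : R -> R) (x : R) :
  (forall t : R, is_derive t 1 f (df t)) -> (forall t, 0 <= t -> 0 <= df t) ->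
  0 <= x -> f 0 <= f x.
Proof.
move=> fdf df0 x0; have [|c /itvP c0 fE] := @MVT_segment _ f df 0 x x0 (fun t _ => fdf t).
  apply: continuous_subspaceT => t; apply: differentiable_continuous.
  by apply/derivable1_diffP; have [] := fdf t.
by rewrite -subr_ge0 fE mulr_ge0 ?subr_ge0// df0// c0.
Qed.

(* The right-hand side minus the left-hand side of the logarithmic form
   vanishes at s = 0 together with its derivative, and its second derivative
   in s is the square (B / A) ^+ 2. *)
Lemma mean_exp_lt m s : `|m| < 1 -> 0 <= s ->
  ((1 + m) * expR s + (1 - m) * expR (- s)) / 2 <= expR (s * m + s ^+ 2 / 2).
Proof.
move=> /ltr_normlP[m1 m2] s0.
(* [A] is cosh + m sinh and [B] is sinh + m cosh, so each is the derivative of the other. *)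
pose A t := ((1 + m) * expR t + (1 - m) * expR (- t)) / 2.
pose B t := ((1 + m) * expR t - (1 - m) * expR (- t)) / 2.
have A_gt0 t : 0 < A t.
  by rewrite divr_gt0// addr_gt0// mulr_gt0 ?expR_gt0//; lra.
have dA (t : R) : is_derive t 1 A (B t).
  rewrite /A; apply: is_derive_eq.
  by rewrite /GRing.scale/= /B; field.
have dB (t : R) : is_derive t 1 B (A t).
  rewrite /B; apply: is_derive_eq.
  by rewrite /GRing.scale/= /A; field.
have D_ge0 t : 0 <= t -> 0 <= m + t - B t / A t.
  move=> t0.
  have D0 : m + 0 - B 0 / A 0 = 0.
    by rewrite /A /B oppr0 expR0; field; lra.
  rewrite -[leLHS]D0.
  pose D u := m + u - B u / A u.
  apply: (@is_derive_ge0_le D (fun u => (B u / A u) ^+ 2) t) t0.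
    rewrite /D => u; have An0 : A u != 0 by rewrite gt_eqF.
    apply: is_derive_eq.
    by rewrite /GRing.scale/=; field.
  by move=> u _; exact: sqr_ge0.
have G0 : s * m + s ^+ 2 / 2 - ln (A s) >= 0.
  have G00 : 0 * m + 0 ^+ 2 / 2 - ln (A 0) = 0.
    rewrite (_ : A 0 = 1) ?ln1; first by ring.
    by rewrite /A oppr0 expR0; field.
  rewrite -[leLHS]G00.
  pose G u := u * m + u ^+ 2 / 2 - ln (A u).
  apply: (@is_derive_ge0_le G (fun u => m + u - B u / A u) s) s0; last exact: D_ge0.
  move=> u; have dln := is_derive1_comp (is_derive1_ln (A_gt0 u)) (dA u).
  have dq : is_derive u 1 (fun v : R => v * m + v ^+ 2 / 2) (m + u).
    by apply: is_derive_eq; rewrite /GRing.scale/=; field.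
  rewrite [B u / A u]mulrC; exact: is_deriveB.
rewrite -[leLHS]lnK; last exact: A_gt0.
by rewrite ler_expR -subr_ge0.
Qed.

(** For [m] equal to 1 or -1 one weight vanishes and the left-hand side is [expR (s * m)]; in
    between both weights are positive and the logarithmic argument applies. *)
Lemma mean_exp_le m s : `|m| <= 1 -> 0 <= s ->
  ((1 + m) * expR s + (1 - m) * expR (- s)) / 2 <= expR (s * m + s ^+ 2 / 2).
Proof.
rewrite le_eqVlt => /predU1P[m1 s0|]; last exact: mean_exp_lt.
have s2 : 0 <= s ^+ 2 / 2 by rewrite divr_ge0// sqr_ge0.
have [m0|m0] := lerP 0 m; [rewrite ger0_norm// in m1|rewrite ltr0_norm// in m1].
- rewrite m1 subrr mul0r addr0 mulrAC mulfV// mul1r ler_expR mulr1.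
  by rewrite lerDl.
- have -> : m = -1 by rewrite -m1 opprK.
  by rewrite subrr mul0r add0r opprK mulrAC mulfV// mul1r ler_expR mulrN1 lerDl.
Qed.

(** Convexity by tangents: the tangent of exp at [s * u] lies below exp at [s] and at [- s]. In the
    combination with weights [1 + u] and [1 - u] the linear terms cancel. *)
Lemma expR_le_chord s u : `|u| <= 1 ->
  expR (s * u) <= ((1 + u) * expR s + (1 - u) * expR (- s)) / 2.
Proof.
rewrite ler_norml => /andP[u1 u2].
have e0 := expR_ge0 (s * u).
have tangent v : expR (s * u) * (1 + (v - s * u)) <= expR v.
  rewrite [leRHS](_ : _ = expR (s * u) * expR (v - s * u)).
    by rewrite ler_wpM2l// expR_ge1Dx.
  by rewrite -expRD addrC subrK.
have h1 : 0 <= 1 + u by lra.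
have h2 : 0 <= 1 - u by lra.
have := lerD (ler_wpM2l h1 (tangent s)) (ler_wpM2l h2 (tangent (- s))).
rewrite ler_pdivlMr//; apply: le_trans.
by rewrite le_eqVlt; apply/orP; left; apply/eqP; ring.
Qed.

(** The chord bound makes the integrand affine, so only the mean enters, and [mean_exp_le] bounds
    the resulting two-point expectation. A bound on the oscillation suffices because a shift of [h]
    factors out of both sides. *)
Lemma hoeffding_lemma d (T : measurableType d) (P : probability T R)
    (h : T -> R) s :
  bmeas h -> (forall x y, `|h x - h y| <= 2) -> 0 <= s ->
  \int[P]_x expR (s * h x) <= expR (s * \int[P]_x h x + s ^+ 2 / 2).
Proof.
move=> bh h2 s0.
have lbh : has_lbound (range h).
  by exists (h point - 2) => _ [x _ <-];
    have := h2 x point; rewrite ler_norml => /andP[]; lra.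
have range0 : range h !=set0 by exists (h point), point.
(* The range has length at most 2, so subtracting its infimum plus 1 puts it in [-1, 1]. *)
pose a := inf (range h) + 1.
have ha x : `|h x - a| <= 1.
  rewrite ler_norml /a; apply/andP; split.
    suff : inf (range h) <= h x by lra.
    by apply: ge_inf => //; exists x.
  suff : h x - 2 <= inf (range h) by lra.
  apply: lb_le_inf => // _ [y _ <-].
  by have := h2 x y; rewrite ler_norml => /andP[]; lra.
pose u x := h x - a.
have bu : bmeas u by apply: bmeasB => //; exact: bmeas_cst.
have hE x : expR (s * h x) = expR (s * a) * expR (s * u x).
  by rewrite -expRD; congr expR; rewrite /u; ring.
have bexp : bmeas (fun x => expR (s * u x)).
  apply: (@bmeas_comp _ _ _ (fun t => expR (s * t)) u) => // t.
  by apply: continuous_comp; [exact: mulrl_continuous|exact: continuous_expR].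
under eq_Rintegral do rewrite hE.
rewrite RintZ//.
have uE : \int[P]_x u x = \int[P]_x h x - a by rewrite RintB ?Rint_cst//; exact: bmeas_cst.
have -> : s * \int[P]_x h x + s ^+ 2 / 2 =
    s * a + (s * \int[P]_x u x + s ^+ 2 / 2) by rewrite uE; ring.
rewrite expRD ler_wpM2l ?expR_ge0//.
apply: le_trans (mean_exp_le _ s0); last by exact: Rint_norm_le.
pose c1 := (expR s + expR (- s)) / 2; pose c2 := (expR s - expR (- s)) / 2.
have bc : bmeas (fun x => c1 + c2 * u x).
  by apply: bmeasD; [exact: bmeas_cst|exact: bmeasZ].
apply: le_trans (Rint_le P bexp bc _) _ => [x|].
  by apply: le_trans (expR_le_chord _ (ha x)) _; rewrite /c1 /c2 -/(u x); lra.
rewrite RintD; [|exact: bmeas_cst|exact: bmeasZ].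
rewrite RintZ// Rint_cst.
by rewrite /c1 /c2 le_eqVlt; apply/orP; left; apply/eqP; field.
Qed.

End hoeffding.

(** * Positive definite kernels *)

Section kernel_forms.
Context (R : realType) (T : Type).
Implicit Types (K : T -> T -> R) (s : seq (R * T)) (x y : T).

(** A list of weighted points stands for a finite signed combination of features: [kform] is its
    squared norm and [kcomb] its value at [x]. With lists, adding one point is an induction step. *)
Definition kform K s : R := \sum_(p <- s) \sum_(q <- s) p.1 * q.1 * K p.2 q.2.
Definition kcomb K s x : R := \sum_(p <- s) p.1 * K p.2 x.

Lemma is_kernelP K : is_kernel K <->
  (forall x y, K x y = K y x) /\ forall s, 0 <= kform K s.
Proof.
split=> -[Ksym Kpos]; split => //.
- case=> [|[a0 x0] s']; first by rewrite /kform big_nil.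
  set s := _ :: s'; have := Kpos (size s) (fun i => (nth (a0, x0) s i).2)
    (fun i => (nth (a0, x0) s i).1).
  rewrite /kform (big_nth (a0, x0)) big_mkord; congr (0 <= _).
  by apply: eq_bigr => i _; rewrite (big_nth (a0, x0)) big_mkord.
- move=> m x a; have := Kpos [seq (a i, x i) | i <- index_enum 'I_m].
  rewrite /kform big_map; congr (0 <= _).
  by apply: eq_bigr => i _; rewrite big_map.
Qed.

Lemma kform_ge0 K s : is_kernel K -> 0 <= kform K s.
Proof. by move=> /is_kernelP[]. Qed.

Lemma kform_cons K a x s : (forall y z, K y z = K z y) ->
  kform K ((a, x) :: s) =
  a ^+ 2 * K x x + 2 * a * kcomb K s x + kform K s.
Proof.
move=> Ksym; rewrite /kform big_cons/= !big_cons/=.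
under [X in _ + X = _]eq_bigr do rewrite big_cons/=.
rewrite big_split/= /kcomb.
have -> : \sum_(q <- s) a * q.1 * K x q.2 = a * kcomb K s x.
  by rewrite mulr_sumr; apply: eq_bigr => q _; rewrite Ksym mulrA.
have -> : \sum_(i <- s) i.1 * a * K i.2 x = a * kcomb K s x.
  by rewrite mulr_sumr; apply: eq_bigr => q _; ring.
by rewrite -/(kcomb K s x); ring.
Qed.

Lemma kformD K1 K2 s :
  kform (fun x y => K1 x y + K2 x y) s = kform K1 s + kform K2 s.
Proof.
rewrite /kform -big_split; apply: eq_bigr => p _.
by rewrite -big_split; apply: eq_bigr => q _; rewrite mulrDr.
Qed.

Lemma kformZ c K s : kform (fun x y => c * K x y) s = c * kform K s.
Proof.
rewrite /kform mulr_sumr; apply: eq_bigr => p _.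
by rewrite mulr_sumr; apply: eq_bigr => q _; ring.
Qed.

(** The common source of the Cauchy-Schwarz inequalities below, for kernels and for inner products.
    If [a = 0] and [b] is nonzero, the chosen [t] gives the value -1. *)
Lemma quadratic_ge0_discr (a b c : R) : 0 <= a ->
  (forall t, 0 <= a * t ^+ 2 + 2 * b * t + c) -> b ^+ 2 <= a * c.
Proof.
rewrite le_eqVlt => /predU1P[<-|a0] h.
  rewrite mul0r; have [->|b0] := eqVneq b 0; first by rewrite expr0n.
  have := h (- (c + 1) / (2 * b)); rewrite mul0r add0r.
  by rewrite mulrC divfK ?mulf_neq0// => h1; exfalso; lra.
have := h (- (b / a)); rewrite -(pmulr_rge0 _ a0).
have -> : a * (a * (- (b / a)) ^+ 2 + 2 * b * - (b / a) + c) = a * c - b ^+ 2.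
  by field; rewrite gt_eqF.
by rewrite subr_ge0.
Qed.

Lemma kernel_diag_ge0 K x : is_kernel K -> 0 <= K x x.
Proof.
move=> /is_kernelP[_ /(_ [:: (1, x)])].
by rewrite /kform big_seq1 big_seq1/= !mul1r.
Qed.

Lemma kernel_CauchySchwarz K s x : is_kernel K ->
  kcomb K s x ^+ 2 <= K x x * kform K s.
Proof.
move=> Kker; apply: quadratic_ge0_discr => [|t]; first exact: kernel_diag_ge0.
have /is_kernelP[Ksym Kpos] := Kker.
by have := Kpos ((t, x) :: s); rewrite kform_cons//; congr (0 <= _); ring.
Qed.

Lemma kernel_diag0 K x y : is_kernel K -> K x x = 0 -> K x y = 0.
Proof.
move=> Kker Kx0; have := kernel_CauchySchwarz [:: (1, y)] x Kker.
rewrite Kx0 mul0r /kcomb big_seq1/= mul1r => Kyx.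
apply/eqP; rewrite Kker.1 -sqrf_eq0 eq_le Kyx; exact: sqr_ge0.
Qed.

(** One step of Gaussian elimination: the Gram kernel of the features projected orthogonally to that
    of [x0]. If [K x0 x0 = 0] the quotient is 0 by convention, which is harmless because [K x0] then
    vanishes identically ([kernel_diag0]). *)
Definition schur_complement K x0 x y := K x y - K x x0 * K x0 y / K x0 x0.

Lemma schur_complement_kernel K x0 : is_kernel K ->
  is_kernel (schur_complement K x0).
Proof.
move=> Kker; apply/is_kernelP; split=> [x y|s].
  rewrite /schur_complement (Kker.1 x y) (Kker.1 x x0) (Kker.1 x0 y).
  by rewrite [K x0 x * _]mulrC.
have -> : kform (schur_complement K x0) s =
    kform K s - kcomb K s x0 ^+ 2 / K x0 x0.
  have -> : kcomb K s x0 ^+ 2 / K x0 x0 = kform (fun x y => (K x0 x0)^-1 * (K x x0 * K x0 y)) s.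
    rewrite kformZ mulrC; congr (_ * _); rewrite expr2 /kcomb /kform mulr_suml.
    apply: eq_bigr => p _; rewrite mulr_sumr; apply: eq_bigr => q _.
    by rewrite (Kker.1 x0 q.2); ring.
  rewrite -[X in _ = _ - X]mul1r -mulNr -kformZ -kformD.
  rewrite /kform; apply: eq_bigr => p _; apply: eq_bigr => q _.
  by rewrite /schur_complement; ring.
have := kernel_diag_ge0 x0 Kker; rewrite le_eqVlt => /predU1P[<-|K0].
  by rewrite invr0 mulr0 subr0 kform_ge0.
rewrite subr_ge0 ler_pdivrMr// mulrC; exact: kernel_CauchySchwarz.
Qed.

Lemma schur_complement0 K x0 y : is_kernel K -> schur_complement K x0 x0 y = 0.
Proof.
move=> Kker; rewrite /schur_complement mulrAC.
have [K0|K0] := eqVneq (K x0 x0) 0; first by rewrite (kernel_diag0 _ Kker K0) K0 !mul0r subr0.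
by rewrite mulfV// mul1r subrr.
Qed.

(** Induction on the points, for all [K1] at once. At the first point [x0], split [K1] into a
    rank-one kernel and its Schur complement. The rank-one part merely rescales the weights in the
    form of [K2]; the complement vanishes at [x0], so this point drops out. *)
Lemma schur_product K1 K2 : is_kernel K1 -> is_kernel K2 ->
  is_kernel (fun x y => K1 x y * K2 x y).
Proof.
move=> K1ker K2ker; apply/is_kernelP; split=> [x y|s].
  by rewrite K1ker.1 K2ker.1.
elim: s K1 K1ker => [|[a0 x0] s IHs] K1 K1ker; first by rewrite /kform big_nil.
pose K' := schur_complement K1 x0.
have K'ker : is_kernel K' := schur_complement_kernel x0 K1ker.
set s0 := _ :: s.
have -> : kform (fun x y => K1 x y * K2 x y) s0 =
    (K1 x0 x0)^-1 * kform K2 [seq (p.1 * K1 p.2 x0, p.2) | p <- s0] +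
    kform (fun x y => K' x y * K2 x y) s0.
  have -> : kform K2 [seq (p.1 * K1 p.2 x0, p.2) | p <- s0] =
      kform (fun x y => K1 x x0 * K1 x0 y * K2 x y) s0.
    rewrite /kform big_map; apply: eq_bigr => p _.
    by rewrite big_map; apply: eq_bigr => q _; rewrite /= (K1ker.1 x0); ring.
  rewrite -kformZ -kformD /kform; apply: eq_bigr => p _; apply: eq_bigr => q _.
  by rewrite /K' /schur_complement; ring.
apply: addr_ge0.
  by rewrite mulr_ge0 ?kform_ge0// invr_ge0 kernel_diag_ge0.
rewrite kform_cons; last by move=> y z; rewrite K'ker.1 K2ker.1.
rewrite {1}/K' schur_complement0// mul0r mulr0 add0r.
rewrite /kcomb big1 ?mulr0 ?add0r; first exact: IHs.
by move=> p _; rewrite K'ker.1 /K' schur_complement0// mul0r mulr0.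
Qed.

End kernel_forms.

Section kernel_integral.
Context (R : realType) (d1 d2 : measure_display).
Context (X : measurableType d1) (Y : measurableType d2).
Context (Q : X -> probability Y R).
Context (mQ : forall A : set Y, measurable A ->
  measurable_fun [set: X] (fun x => Q x A)).

Let Qm (x : X) : {measure set Y -> \bar R} := Q x.
HB.instance Definition _ := isKernel.Build _ _ _ _ _ Qm mQ.
Let Qm1 : forall x, Qm x setT = 1%E.
Proof. by move=> x; exact: probability_setT. Qed.
HB.instance Definition _ := Kernel_isProbability.Build _ _ _ _ _ Qm Qm1.

Lemma bmeas_Rint (f : X * Y -> R) : bmeas f ->
  bmeas (fun x => \int[Q x]_y f (x, y)).
Proof.
move=> bf; have [mf [M fM]] := bf.
have bs x : bmeas (fun y => f (x, y)).
  by split; [exact: measurableT_comp|exists M].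
split; last by exists M => x; apply: Rint_norm_le.
(* Shifting by the bound makes the integrand nonnegative, as the measurability result for kernel
   integrals requires. *)
have bfM : bmeas (fun q => f q + M) by apply: bmeasD => //; exact: bmeas_cst.
rewrite (_ : (fun x => _) = (fun x => \int[Q x]_y (f (x, y) + M) - M)); last first.
  by apply/funext => x; rewrite RintD ?Rint_cst ?addrK//; exact: bmeas_cst.
apply: measurable_funB; last exact: measurable_cst.
apply: measurableT_comp; first exact: fine_measurable.
apply: (measurable_fun_integral_finite_kernel (fun q => (f q + M)%:E) Qm).
  by move=> q; rewrite lee_fin; have := fM q; rewrite ler_norml => /andP[]; lra.
by apply/measurable_EFinP; case: bfM.
Qed.

End kernel_integral.

Lemma bmeas_RintP (R : realType) d1 d2 (X : measurableType d1)
    (Y : measurableType d2) (P : probability Y R) (f : X * Y -> R) : bmeas f ->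
  bmeas (fun x => \int[P]_y f (x, y)).
Proof. by apply: (@bmeas_Rint _ _ _ _ _ (fun=> P)) => A mA; exact: measurable_cst. Qed.

(** * Centring a kernel at a probability law *)

Section centred_kernel.
Context (R : realType) (d : measure_display) (T : measurableType d).
Context (P : probability T R).
Implicit Types (K : T -> T -> R) (s : seq (R * T)).

Definition kmean K x : R := \int[P]_z K x z.
Definition kmean2 K : R := \int[P]_x kmean K x.
(** The inner product of the features of [x] and [y] after subtraction of their mean under [P],
    written without the Hilbert space. *)
Definition kcentre K x y : R := K x y - kmean K x - kmean K y + kmean2 K.

Definition bmeas2 K := bmeas (fun q : T * T => K q.1 q.2).

Lemma bmeas2_sectionr K x : bmeas2 K -> bmeas (K x).
Proof.
move=> [mK [M KM]]; split; last by exists M => y; exact: (KM (x, y)).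
exact: (measurable_fun_pair2 x mK).
Qed.

Lemma bmeas2_comp d' (T' : measurableType d') K (u v : T' -> T) :
  measurable_fun setT u -> measurable_fun setT v ->
  bmeas2 K -> bmeas (fun x => K (u x) (v x)).
Proof.
move=> mu mv [mK [M KM]]; split; last by exists M => x; exact: (KM (u x, v x)).
by apply: (measurableT_comp mK (g := fun x => (u x, v x))); exact: measurable_fun_pair.
Qed.

Lemma bmeas_diag K : bmeas2 K -> bmeas (fun x => K x x).
Proof. by apply: bmeas2_comp; exact: measurable_id. Qed.

Lemma bmeas_kmean K : bmeas2 K -> bmeas (kmean K).
Proof. exact: bmeas_RintP. Qed.

Lemma bmeas_kcomb K s : bmeas2 K -> bmeas (kcomb K s).
Proof.
move=> bK; apply: bmeas_sum => p; apply: bmeasZ; exact: bmeas2_sectionr.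
Qed.

Lemma Rint_kcomb K s : bmeas2 K ->
  \int[P]_z kcomb K s z = \sum_(p <- s) p.1 * kmean K p.2.
Proof.
move=> bK; have bs x := bmeas2_sectionr x bK.
rewrite Rint_sum; last by move=> p; exact: bmeasZ.
by apply: eq_bigr => p _; rewrite RintZ.
Qed.

(** The right-hand side is the expected form of [s] extended by [j] independent points of law [P]
    and weight [c]; each induction step integrates out one of them. The last term is the correction
    for the diagonal pairs. *)
Lemma kform_mean_approx K s (c : R) (j : nat) : is_kernel K -> bmeas2 K ->
  0 <= kform K s + 2 * (j%:R * c) * (\sum_(p <- s) p.1 * kmean K p.2)
       + (j%:R * c) ^+ 2 * kmean2 K
       + j%:R * c ^+ 2 * (\int[P]_z K z z - kmean2 K).
Proof.
move=> Kker bK; elim: j s => [|j IHj] s.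
  by rewrite !mul0r expr0n/= !mul0r mulr0 mul0r !addr0 kform_ge0.
set L := \sum_(p <- s) _; set D := _ - kmean2 K.
have bd := bmeas_diag bK; have bc := bmeas_kcomb s bK; have bm := bmeas_kmean bK.
pose e := 2 * (j%:R * c) * L + (j%:R * c) ^+ 2 * kmean2 K + j%:R * c ^+ 2 * D + kform K s.
have : 0 <= \int[P]_z (c ^+ 2 * K z z + (2 * c * kcomb K s z +
    (2 * (j%:R * c) * c * kmean K z + e))).
  apply: Rintegral_ge0 => z _; have := IHj ((c, z) :: s).
  rewrite kform_cons; last exact: Kker.1.
  rewrite big_cons/= -/L -/D; congr (0 <= _); rewrite /e; ring.
rewrite RintD; [|exact: bmeasZ|]; last first.
  by apply: bmeasD; [exact: bmeasZ|apply: bmeasD; [exact: bmeasZ|exact: bmeas_cst]].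
rewrite RintD; [|exact: bmeasZ|apply: bmeasD; [exact: bmeasZ|exact: bmeas_cst]].
rewrite RintD; [|exact: bmeasZ|exact: bmeas_cst].
rewrite !RintZ// Rint_cst Rint_kcomb// -/L -/(kmean2 K).
have -> : \int[P]_z K z z = D + kmean2 K by rewrite /D subrK.
by congr (0 <= _); rewrite /e -[j.+1]addn1 natrD; ring.
Qed.

(* The limit N --> oo of the previous lemma with j = N and c = t / N: the
   measure t P is approached by sums of N Dirac masses of weight t / N. *)
Lemma kform_mean_ge0 K s (t : R) : is_kernel K -> bmeas2 K ->
  0 <= kform K s + 2 * t * (\sum_(p <- s) p.1 * kmean K p.2) + t ^+ 2 * kmean2 K.
Proof.
move=> Kker bK; set e := (X in 0 <= X); set D := \int[P]_z K z z - kmean2 K.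
have h (N : nat) : 0 <= e + t ^+ 2 * D / N.+1%:R.
  have := kform_mean_approx s (t / N.+1%:R) N.+1 Kker bK.
  have N0 : N.+1%:R != 0 :> R by rewrite pnatr_eq0.
  rewrite (_ : N.+1%:R * (t / N.+1%:R) = t); last by rewrite mulrC divfK.
  congr (0 <= _); rewrite /e -/D; congr (_ + _).
  by move: N0; move: (N.+1%:R : R) => r r0; field.
rewrite leNgt; apply/negP => e0.
have [N] : exists N : nat, `|t ^+ 2 * D| / - e < N.+1%:R.
  exists (Num.truncn (`|t ^+ 2 * D| / - e)).
  by rewrite -natr1; apply: lt_le_trans (truncnS_gt _) _; rewrite natr1.
rewrite ltr_pdivrMr ?oppr_gt0// => hN.
have := h N; rewrite leNgt => /negP; apply.
rewrite -ltrBrDl sub0r ltr_pdivrMr//; apply: le_lt_trans (ler_norm _) _.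
by rewrite [ltRHS]mulrC.
Qed.

(** The centred form of [s] is the form of [K] on [s] minus its total weight times [P], whence the
    value of [t] given to [kform_mean_ge0]. *)
Lemma kcentre_kernel K : is_kernel K -> bmeas2 K -> is_kernel (kcentre K).
Proof.
move=> Kker bK; apply/is_kernelP; split=> [x y|s].
  by rewrite /kcentre Kker.1; ring.
have := kform_mean_ge0 s (- \sum_(p <- s) p.1) Kker bK.
congr (0 <= _).
set a := \sum_(p <- s) p.1; set L := \sum_(p <- s) _.
transitivity (\sum_(p <- s) (\sum_(q <- s) p.1 * q.1 * K p.2 q.2 - a * (p.1 * kmean K p.2)
   - p.1 * L + p.1 * a * kmean2 K)).
  rewrite big_split/= sumrB sumrB -mulr_sumr -/L -!mulr_suml -/a -/(kform K s); ring.
apply: eq_bigr => p _.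
rewrite /kcentre [RHS](_ : _ = \sum_(q <- s) (p.1 * q.1 * K p.2 q.2 - q.1 * (p.1 * kmean K p.2)
   - p.1 * (q.1 * kmean K q.2) + p.1 * q.1 * kmean2 K)); last first.
  by apply: eq_bigr => q _; ring.
by rewrite big_split/= !sumrB -mulr_sumr -/L -!mulr_suml -/a -mulr_sumr -/a.
Qed.

Lemma bmeas2_kcentre K : bmeas2 K -> bmeas2 (kcentre K).
Proof.
move=> bK; have [mg [M gM]] := bmeas_kmean bK.
apply: bmeasD; last exact: bmeas_cst.
apply: bmeasB; [apply: bmeasB => //|].
- by split; [exact: measurableT_comp|exists M].
- by split; [exact: measurableT_comp|exists M].
Qed.

Lemma Rint_kcentre K x : bmeas2 K -> \int[P]_z kcentre K x z = 0.
Proof.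
move=> bK; have bg := bmeas_kmean bK; have bs := bmeas2_sectionr x bK.
rewrite /kcentre RintD ?RintB ?Rint_cst//; last 4 first.
- exact: bmeas_cst.
- by apply: bmeasB => //; exact: bmeas_cst.
- by apply: bmeasB => //; apply: bmeasB => //; exact: bmeas_cst.
- exact: bmeas_cst.
by rewrite -/(kmean K x) -/(kmean2 K) subrr sub0r addNr.
Qed.

Lemma kmean2_ge0 K : is_kernel K -> bmeas2 K -> 0 <= kmean2 K.
Proof.
move=> Kker bK; have := kform_mean_ge0 [::] 1 Kker bK.
by rewrite /kform !big_nil mulr0 !add0r expr1n mul1r.
Qed.

Lemma Rint_kcentre_diag_le K : is_kernel K -> bmeas2 K ->
  (forall x, K x x <= 1) -> \int[P]_z kcentre K z z <= 1.
Proof.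
move=> Kker bK K1; have bg := bmeas_kmean bK; have bd := bmeas_diag bK.
rewrite /kcentre RintD ?RintB ?Rint_cst//; last 3 first.
- exact: bmeasB.
- by apply: bmeasB => //; exact: bmeasB.
- exact: bmeas_cst.
have := kmean2_ge0 Kker bK; rewrite -/(kmean2 K).
have : \int[P]_z K z z <= \int[P]_z 1 by apply: Rint_le => //; exact: bmeas_cst.
rewrite Rint_cst; lra.
Qed.

End centred_kernel.

(** * Independence and Fubini's theorem *)

Section past.
Context (R : realType) (d d' : measure_display).
Context (W : measurableType d) (Z : measurableType d').
Context (Pr : probability W R) (P : probability Z R) (V : nat -> W -> Z).
Hypothesis V_iid : iid_from Pr P V.

Definition past_event (j : nat) (B : nat -> set Z) : set W :=
  [set w | forall i, (i < j)%N -> B i (V i w)].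

Definition past_events (j : nat) : set (set W) :=
  [set past_event j B | B in [set B | forall i, measurable (B i)]].

Lemma past_events_setI j : setI_closed (past_events j).
Proof.
move=> _ _ [B mB <-] [C mC <-]; exists (fun i => B i `&` C i) => [i|].
  exact: measurableI.
apply/seteqP; split=> w /=.
  by move=> h; split=> i /h[].
by move=> [hB hC] i ij; split; [exact: hB|exact: hC].
Qed.

Lemma past_eventsT j : past_events j setT.
Proof. by exists (fun=> setT) => //; apply/seteqP; split. Qed.

Lemma past_event_prob j B : (forall i, measurable (B i)) ->
  Pr (past_event j B) = (\prod_(i < j) P (B i))%E.
Proof.
move=> mB; have [mV PV indep] := V_iid.
pose J := [fset i in iota 0 j]%fset.
have -> : past_event j B = \bigcap_(i in [set` J]) (V i @^-1` B i).
  apply/seteqP; split=> w /= h i.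
    by rewrite /= inE/= mem_iota => /h.
  by move=> ij; apply: (h i); rewrite /= inE/= mem_iota.
rewrite indep//.
transitivity (\prod_(i <- iota 0 j) P (B i))%E.
  rewrite (perm_big (iota 0 j)) /=.
    by apply: eq_bigr => i _; exact: PV.
  by apply: uniq_perm; rewrite ?fset_uniq ?iota_uniq// => i; rewrite inE.
by rewrite -[X in iota X _]/(0%N) -(subn0 j) -/(index_iota 0 j) big_mkord subn0.
Qed.

Lemma past_event_measurable j B : (forall i, measurable (B i)) ->
  measurable (past_event j B).
Proof.
move=> mB; have [mV _ _] := V_iid.
rewrite (_ : past_event j B = \bigcap_(i in [set i | (i < j)%N]) (V i @^-1` B i)).
  apply: bigcap_measurableType => i _; rewrite -[X in measurable X]setTI.
  exact: mV.
by apply/seteqP; split=> w.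
Qed.

(* [W] with the sigma-algebra of [V 0], ..., [V (j - 1)], which plays the role of
   a type of j-tuples of elements of [Z]. *)
Notation past_algebra j := (g_sigma_algebraType (past_events j)).

Lemma measurable_past_algebra j (A : set W) :
  measurable (A : set (past_algebra j)) -> measurable A.
Proof.
apply: (smallest_sub (@sigma_algebra_measurable _ W)).
by move=> _ [B mB <-]; exact: past_event_measurable.
Qed.

Definition past_id j : W -> past_algebra j := id.

Lemma measurable_past_id j : measurable_fun setT (@past_id j).
Proof. by move=> _ A mA; rewrite setTI; exact: (@measurable_past_algebra j). Qed.

HB.instance Definition _ j := isMeasurableFun.Build _ _ W (past_algebra j)
  (past_id j) (@measurable_past_id j).

Lemma measurable_past j i : (i < j)%N ->
  measurable_fun setT (V i : past_algebra j -> Z).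
Proof.
move=> ij _ A mA; rewrite setTI; apply: sub_sigma_algebra.
exists (fun l => if l == i then A else setT) => [l|]; first by case: ifP.
apply/seteqP; split=> w /= h.
  by have := h i ij; rewrite eqxx.
by move=> l lj; case: ifPn => // /eqP ->.
Qed.

(** For fixed [B] both sides are finite measures in [A]: [Pr] restricted to the event of [V j], and
    [Pr] scaled by the mass of [B]. They agree on the pi-system [past_events j], because
    intersecting a past event with that of [V j] gives a past event at [j.+1]. *)
Lemma past_indep j (A : set W) (B : set Z) :
  measurable (A : set (past_algebra j)) -> measurable B ->
  Pr (A `&` V j @^-1` B) = (Pr A * P B)%E.
Proof.
move=> mA mB; have [mV PV indep] := V_iid.
have mVB : measurable (V j @^-1` B) by rewrite -[X in measurable X]setTI; exact: mV.
pose m1' : {measure set (past_algebra j) -> \bar R} :=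
  pushforward (mrestr Pr mVB) (past_id j).
have PB0 : 0 <= fine (P B) by rewrite fine_ge0.
pose m2 : {measure set (past_algebra j) -> \bar R} :=
  mscale (NngNum PB0) (distribution Pr (past_id j)).
pose m1 := m1' (@measurable_past_id j).
suff : m1 A = m2 A.
  rewrite /m1 /m1' /m2 /= /distribution /pushforward /mrestr /mscale/= preimage_id => ->.
  by rewrite fineK 1?muleC// fin_num_measure.
apply: (@measure_unique _ R (past_algebra j) (past_events j) (fun=> setT)
  erefl _ _ _ m1 m2 _ _ A mA).
- exact: past_events_setI.
- by move=> _; exact: past_eventsT.
- by rewrite bigcup_const.
- move=> _ [C mC <-].
  rewrite /m1 /m1' /m2 /= /distribution /pushforward /mrestr /mscale/= preimage_id.
  rewrite past_event_prob// fineK ?fin_num_measure//.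
  pose D i := if i == j then B else C i.
  rewrite (_ : _ `&` _ = past_event j.+1 D); last first.
    apply/seteqP; split=> w /=.
      move=> [h hB] i; rewrite ltnS leq_eqVlt => /predU1P[->|ij].
        by rewrite /D eqxx.
      by rewrite /D ltn_eqF//; exact: h.
    move=> h; split.
      by move=> i ij; have := h i (ltnW ij); rewrite /D ltn_eqF.
    by have := h j (leqnn _); rewrite /D eqxx.
  rewrite past_event_prob; last by move=> i; rewrite /D; case: ifP.
  rewrite big_ord_recr/= /D eqxx muleC; congr (_ * _)%E.
  by apply: eq_bigr => i _; rewrite ltn_eqF.
- move=> _; rewrite /m1 /m1' /= /pushforward /mrestr.
  by apply: le_lt_trans (probability_le1 _ _) (ltry _); rewrite preimage_setT setTI.
Qed.

(** By [past_indep] the law of the pair formed by the past and [V j] is a product measure, so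
    Tonelli's theorem applies. *)
Lemma past_fubini j (F : past_algebra j * Z -> \bar R) :
  (forall q, 0 <= F q)%E -> measurable_fun setT F ->
  (\int[Pr]_w F (w, V j w) = \int[Pr]_w \int[P]_z F (w, z))%E.
Proof.
move=> F0 mF; have [mV PV indep] := V_iid.
pose f (w : W) : past_algebra j * Z := (w, V j w).
have mf : measurable_fun setT f.
  by apply: measurable_fun_pair => //; exact: measurable_past_id.
pose P1 : probability (past_algebra j) R := distribution Pr (past_id j).
pose f' : {mfun W >-> (past_algebra j * Z)%type} :=
  HB.pack f (isMeasurableFun.Build _ _ W (past_algebra j * Z)%type f mf).
transitivity (\int[pushforward Pr f]_q F q)%E.
  by rewrite ge0_integral_pushforward.
transitivity (\int[(P1 \x P)%E]_q F q)%E.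
  apply: eq_measure_integral => A mA _.
  apply/esym; apply: (@product_measure_unique _ _ _ _ _ P1 P (distribution Pr f')) => // A' B mA' mB.
  exact: (past_indep mA' mB).
rewrite fubini_tonelli1//.
have mFF : measurable_fun setT (fubini_F P F) by exact: measurable_fun_fubini_tonelli_F.
rewrite [LHS](ge0_integral_pushforward (@measurable_past_id j) Pr measurableT mFF)//.
by move=> w _; exact: integral_ge0.
Qed.

End past.

(** * Concentration of the empirical measure *)

(** The newest observation is at the head, so [kform_cons] splits it off and leaves the past. *)
Fixpoint sample (R : realType) (Z : Type) (x : nat -> Z) (j : nat) : seq (R * Z) :=
  if j is j'.+1 then (1, x j') :: sample R x j' else [::].

(* The distance between the empirical measure of x 0, ..., x (n - 1) and P in
   the semi-norm given by the kernel K. *)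
Definition discrepancy (R : realType) d (Z : measurableType d)
    (P : probability Z R) (K : Z -> Z -> R) (n : nat) (x : nat -> Z) : R :=
  Num.sqrt (kform (kcentre P K) (sample R x n)) / n%:R.

Section sample_measurable.
Context (R : realType) (d d' : measure_display).
Context (E : measurableType d) (Z : measurableType d').
Context (K : Z -> Z -> R) (bK : bmeas2 K) (Ksym : forall x y, K x y = K y x).

(** Measurability is required only for indices below [j]: the lemma is also applied over the
    sigma-algebra of the first [j] observations, where later ones need not be measurable. *)
Lemma bmeas_kcomb_sample (V : nat -> E -> Z) (j : nat) (u : E -> Z) :
  (forall i, (i < j)%N -> measurable_fun setT (V i)) -> measurable_fun setT u ->
  bmeas (fun e => kcomb K (sample R (V ^~ e) j) (u e)).
Proof.
move=> mV mu; elim: j mV => [|j IHj] mV.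
  rewrite /kcomb /=; under eq_fun do rewrite big_nil; exact: bmeas_cst.
rewrite /kcomb /=; under eq_fun do rewrite big_cons.
apply: bmeasD; last by apply: IHj => i ij; apply: mV; exact: ltnW.
by apply/bmeasZ/bmeas2_comp => //; exact: mV.
Qed.

Lemma bmeas_kform_sample (V : nat -> E -> Z) (j : nat) :
  (forall i, (i < j)%N -> measurable_fun setT (V i)) ->
  bmeas (fun e => kform K (sample R (V ^~ e) j)).
Proof.
elim: j => [|j IHj] mV.
  by rewrite /kform /=; under eq_fun do rewrite big_nil; exact: bmeas_cst.
rewrite /=; under eq_fun do rewrite kform_cons//.
have mV' i : (i < j)%N -> measurable_fun setT (V i) by move=> ij; apply: mV; exact: ltnW.
apply: bmeasD; [apply: bmeasD|exact: IHj]; apply: bmeasZ.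
  by apply: bmeas2_comp => //; exact: mV.
by apply: bmeas_kcomb_sample => //; exact: mV.
Qed.

End sample_measurable.

Section lipschitz.
Context (R : realType) (Z : Type) (K : Z -> Z -> R) (Kker : is_kernel K).
Hypothesis K_diam : forall x y, K x x - 2 * K x y + K y y <= 4.

(** The square of the triangle inequality for replacing the feature of [z'] by that of [z], at
    distance at most 2. Here [N] is the squared norm of the old sum, [D] that of the difference of
    features, and [b] their inner product. *)
Lemma kform_cons_swap s z z' :
  kform K ((1, z) :: s) <=
  kform K ((1, z') :: s) + 4 * Num.sqrt (kform K ((1, z') :: s)) + 4.
Proof.
set S' := (1, z') :: s; set N := kform K S'.
have N0 : 0 <= N by exact: kform_ge0.
set D := K z z - 2 * K z z' + K z' z'.
pose b := kcomb K S' z - kcomb K S' z'.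
have D0 : 0 <= D.
  have := kform_ge0 [:: (1, z); (-1, z')] Kker.
  rewrite /kform !big_cons !big_nil/= (Kker.1 z' z); congr (0 <= _).
  by rewrite /D; ring.
have bDN : b ^+ 2 <= D * N.
  apply: quadratic_ge0_discr => // t.
  have := kform_ge0 [:: (t, z), (- t, z') & S'] Kker.
  rewrite (kform_cons _ _ (_ :: S') Kker.1) (kform_cons _ _ S' Kker.1) -/N.
  have -> : kcomb K ((- t, z') :: S') z = - t * K z' z + kcomb K S' z.
    by rewrite /kcomb big_cons.
  by congr (0 <= _); rewrite /b /D (Kker.1 z' z); ring.
have bN : b <= 2 * Num.sqrt N.
  apply: le_trans (ler_norm _) _; rewrite -sqrtr_sqr.
  have -> : 2 * Num.sqrt N = Num.sqrt (4 * N).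
    have -> : 4 * N = 2 ^+ 2 * N by ring.
    by rewrite sqrtrM ?sqr_ge0// sqrtr_sqr ger0_norm.
  by rewrite ler_sqrt ?mulr_ge0//; apply: le_trans bDN _; rewrite ler_wpM2r// K_diam.
have -> : kform K ((1, z) :: s) = N + 2 * b + D.
  rewrite /N /b /S' !(kform_cons _ _ _ Kker.1) /kcomb !big_cons/= -!/(kcomb K s _).
  by rewrite /D (Kker.1 z' z); ring.
by have := K_diam z z'; rewrite -/D; lra.
Qed.

Lemma sqrt_kform_cons_lipschitz s z z' (c : R) : 0 <= c ->
  `|Num.sqrt (kform K ((1, z) :: s) + c) - Num.sqrt (kform K ((1, z') :: s) + c)| <= 2.
Proof.
move=> c0; suff le2 u v :
    Num.sqrt (kform K ((1, u) :: s) + c) <= Num.sqrt (kform K ((1, v) :: s) + c) + 2.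
  by rewrite ler_norml; have := le2 z z'; have := le2 z' z; lra.
set N := kform K ((1, v) :: s).
have N0 : 0 <= N by exact: kform_ge0.
have h : kform K ((1, u) :: s) + c <= (Num.sqrt (N + c) + 2) ^+ 2.
  have := kform_cons_swap s u v; rewrite -/N => hN.
  rewrite sqrrD sqr_sqrtr ?addr_ge0//.
  have : Num.sqrt N <= Num.sqrt (N + c) by rewrite ler_sqrt ?addr_ge0// lerDl.
  lra.
apply: le_trans (_ : Num.sqrt ((Num.sqrt (N + c) + 2) ^+ 2) <= _).
  by rewrite ler_sqrt// sqr_ge0.
by rewrite sqrtr_sqr ger0_norm// addr_ge0// sqrtr_ge0.
Qed.

End lipschitz.

Section concentration.
Context (R : realType) (d d' : measure_display).
Context (W : measurableType d) (Z : measurableType d').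
Context (Pr : probability W R) (P : probability Z R) (V : nat -> W -> Z).
Hypothesis V_iid : iid_from Pr P V.
Context (K : Z -> Z -> R) (Kker : is_kernel K) (bK : bmeas2 K).
Hypothesis K_diam : forall x y, K x x - 2 * K x y + K y y <= 4.
Hypothesis K_centred : forall x, \int[P]_z K x z = 0.
Hypothesis K_var : \int[P]_z K z z <= 1.

Let q j w := kform K (sample R (V ^~ w) j).

Let mV i : measurable_fun setT (V i). Proof. by case: V_iid. Qed.

Lemma bmeas_exp_sqrt d0 (E : measurableType d0) (s c : R) (f : E -> R) :
  bmeas f -> bmeas (fun e => expR (s * Num.sqrt (f e + c))).
Proof.
move=> bf.
apply: (@bmeas_comp _ _ _ (fun t => expR (s * Num.sqrt (t + c))) f) => // t.
apply: continuous_comp; last exact: continuous_expR.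
apply: continuous_comp; last exact: mulrl_continuous.
apply: continuous_comp; last exact: sqrt_continuous.
by apply: continuousD; [exact: cvg_id|exact: cvg_cst].
Qed.

Let bmeas_kform_cons (S : seq (R * Z)) : bmeas (fun z => kform K ((1, z) :: S)).
Proof.
under eq_fun do rewrite (kform_cons _ _ _ Kker.1).
apply: bmeasD; last exact: bmeas_cst.
apply: bmeasD; apply: bmeasZ; first exact: bmeas_diag.
exact: bmeas_kcomb.
Qed.

(* Let S_j be the centred sum in the space of [K]. The process
   exp (s sqrt (|S_j|^2 + n - j) - j s^2 / 2) is a supermartingale: as a function of
   the next observation the square root has oscillation at most 2, so Hoeffding's
   lemma applies, and by Jensen its mean is at most sqrt (|S_j|^2 + 1 + n - j - 1). *)
Lemma exp_step (s c : R) (S : seq (R * Z)) : 0 <= s -> 0 <= c ->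
  \int[P]_z expR (s * Num.sqrt (kform K ((1, z) :: S) + c)) <=
  expR (s ^+ 2 / 2) * expR (s * Num.sqrt (kform K S + (1 + c))).
Proof.
move=> s0 c0; have bc := bmeas_kcomb S bK; have bd := bmeas_diag bK.
have bN := bmeas_kform_cons S.
have bNc : bmeas (fun z => kform K ((1, z) :: S) + c).
  by apply: bmeasD => //; exact: bmeas_cst.
pose h z := Num.sqrt (kform K ((1, z) :: S) + c).
have bh : bmeas h by apply: (bmeas_comp _ bNc); exact: sqrt_continuous.
apply: le_trans (hoeffding_lemma P bh _ s0) _ => [x y|].
  exact: sqrt_kform_cons_lipschitz.
rewrite -expRD ler_expR [leRHS]addrC lerD2r ler_wpM2l//.
have NE : \int[P]_z (kform K ((1, z) :: S) + c) =
    \int[P]_z K z z + kform K S + c.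
  rewrite RintD ?Rint_cst//; last exact: bmeas_cst.
  under eq_Rintegral do rewrite (kform_cons _ _ _ Kker.1).
  rewrite RintD ?Rint_cst//; [|by apply: bmeasD; exact: bmeasZ|exact: bmeas_cst].
  rewrite RintD; [|exact: bmeasZ|exact: bmeasZ].
  rewrite !RintZ// Rint_kcomb// big1; first by ring.
  by move=> p _; rewrite /kmean K_centred mulr0.
have h0 : 0 <= \int[P]_z h z by apply: Rintegral_ge0 => z _; exact: sqrtr_ge0.
rewrite -[leLHS]ger0_norm// -sqrtr_sqr ler_sqrt; last first.
  by rewrite addr_ge0 ?kform_ge0// addr_ge0.
apply: le_trans (sqr_Rint_le P bh) _.
rewrite (_ : \int[P]_x h x ^+ 2 = \int[P]_z (kform K ((1, z) :: S) + c)); last first.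
  by apply: eq_Rintegral => z _; rewrite sqr_sqrtr// addr_ge0// kform_ge0.
by rewrite NE; have := K_var; lra.
Qed.

(** Integrating out the latest observation raises [c] by 1 ([exp_step]), so the induction runs over
    all [c >= 0]; the tail bound takes [c = 0]. *)
Lemma exp_moment (s c : R) (j : nat) : 0 <= s -> 0 <= c ->
  (\int[Pr]_w (expR (s * Num.sqrt (q j w + c)))%:E <=
   (expR (j%:R * (s ^+ 2 / 2) + s * Num.sqrt (j%:R + c)))%:E)%E.
Proof.
move=> s0; elim: j c => [|j IHj] c c0.
  under eq_integral do rewrite /q /kform big_nil add0r.
  by rewrite integral_cst// probability_measure_setT mule1 mul0r !add0r.
pose F (p : g_sigma_algebraType (past_events V j) * Z) : \bar R :=
  (expR (s * Num.sqrt (kform K ((1, p.2) :: sample R (V ^~ p.1) j) + c)))%:E.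
have bN : bmeas (fun p : g_sigma_algebraType (past_events V j) * Z =>
    kform K ((1, p.2) :: sample R (V ^~ p.1) j)).
  under eq_fun do rewrite (kform_cons _ _ _ Kker.1).
  pose V' i (p : g_sigma_algebraType (past_events V j) * Z) := V i p.1.
  have mV' i : (i < j)%N -> measurable_fun setT (V' i).
    move=> ij; apply: measurableT_comp; last exact: measurable_fst.
    exact: measurable_past.
  apply: bmeasD; last exact: (@bmeas_kform_sample _ _ _ _ _ K bK Kker.1 V').
  apply: bmeasD; apply: bmeasZ.
    by apply: bmeas2_comp => //; exact: measurable_snd.
  by apply: (@bmeas_kcomb_sample _ _ _ _ _ K bK V' j snd) => //; exact: measurable_snd.
have mF : measurable_fun setT F.
  by apply/measurable_EFinP; case: (bmeas_exp_sqrt s c bN).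
have -> : (\int[Pr]_w (expR (s * Num.sqrt (q j.+1 w + c)))%:E =
    \int[Pr]_w F (w, V j w))%E by [].
rewrite (past_fubini V_iid)//; last by move=> p; rewrite lee_fin expR_ge0.
have bz (w : W) : bmeas (fun z =>
    expR (s * Num.sqrt (kform K ((1, z) :: sample R (V ^~ w) j) + c))).
  exact/bmeas_exp_sqrt/bmeas_kform_cons.
have bq : bmeas (fun w => kform K (sample R (V ^~ w) j)).
  by apply: bmeas_kform_sample => //; exact: Kker.1.
apply: le_trans (_ : \int[Pr]_w ((expR (s ^+ 2 / 2))%:E *
    (expR (s * Num.sqrt (q j w + (1 + c))))%:E) <= _)%E.
  apply: ge0_le_integral => //.
  - by move=> w _; apply: integral_ge0 => z _; rewrite lee_fin expR_ge0.
  - have mFF : measurable_fun setT (fubini_F P F).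
      by apply: measurable_fun_fubini_tonelli_F => // p; rewrite lee_fin expR_ge0.
    exact: (measurableT_comp mFF (measurable_past_id V_iid (j := j))).
  - apply: measurable_funeM; apply/measurable_EFinP.
    by case: (bmeas_exp_sqrt s (1 + c) bq).
  - move=> w _; rewrite -EFinM -(EFin_Rint P (bz w)) lee_fin.
    exact: exp_step.
rewrite ge0_integralZl//; last first.
  by apply/measurable_EFinP; case: (bmeas_exp_sqrt s (1 + c) bq).
apply: (@le_trans _ _ ((expR (s ^+ 2 / 2))%:E *
    (expR (j%:R * (s ^+ 2 / 2) + s * Num.sqrt (j%:R + (1 + c))))%:E)%E).
  by apply: lee_wpmul2l; [rewrite lee_fin expR_ge0|apply: IHj; rewrite addr_ge0].
rewrite -EFinM lee_fin -expRD ler_expR.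
have -> : j.+1%:R + c = j%:R + (1 + c) by rewrite -natr1 addrA.
by rewrite -natr1; lra.
Qed.

Lemma centred_concentration (n : nat) (t : R) : (0 < n)%N -> 0 <= t ->
  (Pr [set w | ((Num.sqrt n%:R)^-1 * (1 + t) <= Num.sqrt (q n w) / n%:R)%R] <=
   (expR (- (t ^+ 2 / 2)))%:E)%E.
Proof.
move=> n0 t0; have n0R : 0 < n%:R :> R by rewrite ltr0n.
have sn0 : 0 < Num.sqrt n%:R :> R by rewrite sqrtr_gt0.
have snn : Num.sqrt n%:R * Num.sqrt n%:R = n%:R :> R by rewrite -expr2 sqr_sqrtr// ltW.
have nV : (Num.sqrt n%:R)^-1 * n%:R = Num.sqrt n%:R :> R.
  by rewrite -[X in _ * X = _]snn mulrA mulVf ?mul1r// gt_eqF.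
(* The optimal Chernoff parameter: the exponent becomes t^2 / 2 + t - t (1 + t) = - t^2 / 2. *)
set s := t / Num.sqrt n%:R; have s0 : 0 <= s by rewrite divr_ge0// ltW.
set A := (X in Pr X).
have bq : bmeas (q n) by apply: bmeas_kform_sample => //; exact: Kker.1.
pose f w := expR (s * Num.sqrt (q n w + 0)).
have mf : measurable_fun setT f by case: (bmeas_exp_sqrt s 0 bq).
set a := expR (s * (Num.sqrt n%:R * (1 + t))).
have fA w : A w -> a <= f w.
  rewrite /A /= ler_pdivlMr// => h; rewrite ler_expR ler_wpM2l// addr0.
  by rewrite mulrAC nV in h.
have mA : measurable A.
  have mq : measurable_fun setT (fun w => Num.sqrt (q n w) / n%:R).
    by case: (bmeasM (bmeas_comp (@sqrt_continuous R) bq) (bmeas_cst _ n%:R^-1)).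
  have := mq measurableT `[(Num.sqrt n%:R)^-1 * (1 + t), +oo[%classic (measurable_itv _).
  by rewrite setTI; congr measurable; apply/seteqP; split=> w /=; rewrite in_itv/= andbT.
have h : (a%:E * Pr A <= (expR (n%:R * (s ^+ 2 / 2) + s * Num.sqrt n%:R))%:E)%E.
  apply: le_trans (_ : \int[Pr]_w (f w)%:E <= _)%E; last first.
    by have := exp_moment n s0 (lexx 0); rewrite addr0.
  rewrite -integral_cst//.
  apply: le_trans (_ : \int[Pr]_(w in A) (f w)%:E <= _)%E.
    apply: ge0_le_integral => //.
    - by move=> w _; rewrite lee_fin expR_ge0.
    - by apply/measurable_EFinP; exact: measurable_funS mf.
  apply: ge0_subset_integral => //; first exact/measurable_EFinP.
  by move=> w _; rewrite lee_fin expR_ge0.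
have a0 : 0 < a by exact: expR_gt0.
have PrA : Pr A \is a fin_num by exact: fin_num_measure.
move: h; rewrite -(fineK PrA) -EFinM !lee_fin -ler_pdivlMl// => /le_trans; apply.
rewrite /a -expRN -expRD ler_expR le_eqVlt; apply/orP; left; apply/eqP.
have sr : s * Num.sqrt n%:R = t by rewrite /s divfK// gt_eqF.
have s2 : n%:R * (s ^+ 2 / 2) = t ^+ 2 / 2.
  by rewrite -[in LHS]snn -sr; ring.
by rewrite s2 mulrA sr; field.
Qed.


End concentration.

Section discrepancy.
Context (R : realType) (d d' : measure_display).
Context (W : measurableType d) (Z : measurableType d').
Context (Pr : probability W R) (P : probability Z R) (V : nat -> W -> Z).
Context (K : Z -> Z -> R) (Kker : is_kernel K) (bK : bmeas2 K).

Lemma measurable_discrepancy n : (forall i, measurable_fun setT (V i)) ->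
  measurable_fun setT (fun w => discrepancy P K n (V ^~ w)).
Proof.
move=> mV; have bC := bmeas2_kcentre P bK.
have bq : bmeas (fun w => kform (kcentre P K) (sample R (V ^~ w) n)).
  by apply: bmeas_kform_sample => //; exact: (kcentre_kernel P Kker bK).1.
by case: (bmeasM (bmeas_comp (@sqrt_continuous R) bq) (bmeas_cst _ n%:R^-1)).
Qed.

Lemma discrepancy_concentration (n : nat) (t : R) :
  iid_from Pr P V -> (forall x y, `|K x y| <= 1) -> (0 < n)%N -> 0 <= t ->
  (Pr [set w | ((Num.sqrt n%:R)^-1 * (1 + t) <= discrepancy P K n (V ^~ w))%R] <=
   (expR (- (t ^+ 2 / 2)))%:E)%E.
Proof.
move=> V_iid K1 n0 t0; apply: (centred_concentration V_iid) => //.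
- exact: kcentre_kernel.
- exact: bmeas2_kcentre.
(* The mean terms cancel in a squared distance, so centring leaves the bound 4 intact. *)
- move=> x y; rewrite /kcentre.
  have := K1 x x; have := K1 x y; have := K1 y y.
  by rewrite !ler_norml => /andP[? ?] /andP[? ?] /andP[? ?]; lra.
- by move=> x; exact: Rint_kcentre.
- apply: Rint_kcentre_diag_le => // x.
  by apply: le_trans (K1 x x); exact: ler_norm.
Qed.

End discrepancy.

(** Centring is linear in the kernel and preserves positivity, so the centred form of
    [c ^+ 2 * K1 - K2] is nonnegative on the sample. The bound involves [K1] alone, which controls a
    parameter-dependent [K2] uniformly. *)
Lemma le_discrepancy (R : realType) d (Z : measurableType d)
    (P : probability Z R) (K1 K2 : Z -> Z -> R) (c : R) n x :
  0 <= c -> is_kernel K1 -> bmeas2 K1 -> bmeas2 K2 ->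
  is_kernel (fun x y => c ^+ 2 * K1 x y - K2 x y) ->
  discrepancy P K2 n x <= c * discrepancy P K1 n x.
Proof.
move=> c0 K1ker b1 b2 Dker.
have bcK1 : bmeas2 (fun x y => c ^+ 2 * K1 x y) by exact: bmeasZ.
have bD : bmeas2 (fun x y => c ^+ 2 * K1 x y - K2 x y) by exact: bmeasB.
have mD y : kmean P (fun x y => c ^+ 2 * K1 x y - K2 x y) y =
    c ^+ 2 * kmean P K1 y - kmean P K2 y.
  rewrite /kmean RintB ?RintZ//; try exact: bmeas2_sectionr.
  by apply: bmeasZ; exact: bmeas2_sectionr.
have m2D : kmean2 P (fun x y => c ^+ 2 * K1 x y - K2 x y) = c ^+ 2 * kmean2 P K1 - kmean2 P K2.
  rewrite /kmean2; under eq_Rintegral do rewrite mD.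
  have bm1 := bmeas_kmean P b1; have bm2 := bmeas_kmean P b2.
  by rewrite RintB ?RintZ//; exact: bmeasZ.
set s := sample R x n.
have h : 0 <= kform (fun x y => c ^+ 2 * kcentre P K1 x y + (- 1) * kcentre P K2 x y) s.
  have := kform_ge0 s (kcentre_kernel P Dker bD).
  congr (0 <= _); apply: eq_bigr => p _; apply: eq_bigr => q _.
  by rewrite /kcentre !mD m2D; ring.
rewrite kformD !kformZ mulN1r subr_ge0 in h.
rewrite /discrepancy -/s mulrA ler_wpM2r// ?invr_ge0//.
rewrite -(ger0_norm c0) -sqrtr_sqr -sqrtrM ?sqr_ge0// ler_sqrt//.
by rewrite mulr_ge0 ?sqr_ge0// kform_ge0//; exact: kcentre_kernel.
Qed.

(** * Hilbert spaces and mean embeddings *)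

Section rkhs_inner.
Context (R : realType) (T : Type) (k : T -> T -> R) (H : @rkhs R T k).
Implicit Types f g h : H.

Local Notation "'[ f , g ]" := (inner H f g).

Lemma innerC f g : '[f, g] = '[g, f].
Proof. by rewrite hermC/= expr0 mul1r. Qed.

Lemma innerDl f g h : '[f + g, h] = '[f, h] + '[g, h].
Proof. exact: linearDl. Qed.

Lemma innerZl (a : R) f h : '[a *: f, h] = a * '[f, h].
Proof. by rewrite linearZl_LR. Qed.

Lemma innerDr f g h : '[h, f + g] = '[h, f] + '[h, g].
Proof. by rewrite innerC innerDl !(innerC h). Qed.

Lemma innerZr (a : R) f h : '[h, a *: f] = a * '[h, f].
Proof. by rewrite innerC innerZl innerC. Qed.

Lemma innerNl f h : '[- f, h] = - '[f, h].
Proof. by rewrite -scaleN1r innerZl mulN1r. Qed.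

Lemma innerBl f g h : '[f - g, h] = '[f, h] - '[g, h].
Proof. by rewrite innerDl innerNl. Qed.

Lemma innerBr f g h : '[h, f - g] = '[h, f] - '[h, g].
Proof. by rewrite innerC innerBl !(innerC h). Qed.

Lemma inner0l h : '[0, h] = 0.
Proof. by rewrite -(scale0r 0) innerZl mul0r. Qed.

Lemma inner_suml (I : Type) (s : seq I) (F : I -> H) h :
  '[\sum_(i <- s) F i, h] = \sum_(i <- s) '[F i, h].
Proof. by elim/big_rec2: _ => [|i x y _ <-]; rewrite ?inner0l// innerDl. Qed.

Lemma inner_sumr (I : Type) (s : seq I) (F : I -> H) h :
  '[h, \sum_(i <- s) F i] = \sum_(i <- s) '[h, F i].
Proof. by rewrite innerC inner_suml; apply: eq_bigr => i _; rewrite innerC. Qed.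

Lemma inner_ge0 f : 0 <= '[f, f].
Proof. by rewrite -norm_inner sqr_ge0. Qed.

Lemma norm_inner_le f g : `|'[f, g]| <= `|f| * `|g|.
Proof.
rewrite -ler_sqr ?nnegrE ?mulr_ge0// real_normK ?num_real// exprMn !norm_inner mulrC.
apply: quadratic_ge0_discr => [|t]; first exact: inner_ge0.
have := inner_ge0 (f + t *: g); congr (0 <= _).
by rewrite !innerDl !innerDr !innerZl !innerZr (innerC g f); ring.
Qed.

Lemma inner_inj f g : (forall h, '[h, f] = '[h, g]) -> f = g.
Proof.
move=> fg; apply/eqP; rewrite -subr_eq0 -normr_eq0 -sqrf_eq0 norm_inner.
by rewrite innerBr fg subrr.
Qed.

Lemma cvg_inner (u : nat -> H) f h : u @ \oo --> f -> '[u n, h] @[n --> \oo] --> '[f, h].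
Proof.
move=> uf; apply/cvgrPdist_le => e e0.
have h0 : 0 < `|h| + 1 by rewrite ltr_wpDl.
have e1 : 0 < e / (`|h| + 1) by rewrite divr_gt0.
have /cvgrPdist_le/(_ _ e1) := uf; apply: filterS => n hn.
rewrite -innerBl; apply: le_trans (norm_inner_le _ _) _.
apply: le_trans (ler_wpM2r _ hn) _ => //.
by rewrite -mulrA ger_pMr// ler_pdivrMl// mulr1 lerDl.
Qed.

(* Minimise |f|^2 / 2 - L f over the subspace S: by the parallelogram law every
   minimising sequence is Cauchy. *)
Lemma subspace_representer (S : set H) (L : H -> R) (c : R) :
  S 0 -> (forall a f g, S f -> S g -> S (a *: f + g)) ->
  (forall a f g, L (a *: f + g) = a * L f + L g) ->
  (forall f, `|L f| <= c * `|f|) ->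
  exists (u : nat -> H) (m : H), [/\ forall n, S (u n), u @ \oo --> m &
    forall s, S s -> '[s, m] = L s].
Proof.
move=> S0 Slin Llin Lc.
have SZ a f : S f -> S (a *: f) by move=> Sf; rewrite -[_ *: _]addr0; exact: Slin.
have L0 : L 0 = 0 by have := Llin 1 0 0; rewrite scaler0 addr0; lra.
have LZ a f : L (a *: f) = a * L f by rewrite -[a *: f]addr0 Llin L0 addr0.
have LD f g : L (f + g) = L f + L g by rewrite -{1}[f]scale1r Llin mul1r.
pose J f := `|f| ^+ 2 - 2 * L f.
have Jlb f : - c ^+ 2 <= J f.
  have := Lc f; have := sqr_ge0 (`|f| - c); have := ler_norm (L f); rewrite /J; nra.
have hinf : has_inf [set J f | f in S].
  split; first by exists (J 0), 0.
  by exists (- c ^+ 2) => _ [f _ <-].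
set I := inf [set J f | f in S].
have JI f : S f -> I <= J f by move=> Sf; apply: ge_inf; [exact: hinf.2|exists f].
have [u uP] : {u : nat -> H & forall n, S (u n) /\ J (u n) < I + n.+1%:R^-1}.
  apply: (@choice _ _ (fun n f => S f /\ J f < I + n.+1%:R^-1)) => n.
  have e0 : 0 < n.+1%:R^-1 :> R by rewrite invr_gt0 ltr0n.
  by have [_ [f Sf <-] h] := inf_adherent e0 hinf; exists f.
have close f g : S f -> S g -> `|f - g| ^+ 2 <= 2 * (J f - I) + 2 * (J g - I).
  move=> Sf Sg.
  have Sm : S (2^-1 *: (f + g)).
    by apply: SZ; rewrite -[f]scale1r; exact: Slin.
  have := JI _ Sm; rewrite /J LZ LD !norm_inner !innerZl !innerZr.
  rewrite innerBl !innerBr innerDl !innerDr (innerC g f); lra.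
have ucauchy : cauchy (u @ \oo).
  apply/cauchy_ballP => e e0; rewrite near_map2.
  have e2 : 0 < e ^+ 2 / 4 by rewrite divr_gt0// exprn_gt0.
  near=> i j.
  have ui : i.+1%:R^-1 < e ^+ 2 / 4.
    by near: i; exact: near_infty_natSinv_lt (PosNum e2).
  have uj : j.+1%:R^-1 < e ^+ 2 / 4.
    by near: j; exact: near_infty_natSinv_lt (PosNum e2).
  have [Si Ji] := uP i; have [Sj Jj] := uP j.
  rewrite -ball_normE/= -ltr_sqr ?nnegrE ?(ltW e0)//.
  apply: le_lt_trans (close _ _ Si Sj) _.
  move: ui uj Ji Jj; move: (i.+1%:R^-1) (j.+1%:R^-1) => a b; lra.
have /cvg_ex[m um] : cvg (u @ \oo) by apply/cauchy_cvgP.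
(* [S] is not assumed closed, so [m] is returned with its approximating sequence and not as a member
   of [S]. *)
exists u, m; split => // [n|s Ss]; first by case: (uP n).
(* Along the line [t *: s + u n] the excess of [J] over [I] is a nonnegative quadratic in [t] whose
   constant term is below [n.+1%:R^-1]; its discriminant bounds the defect. *)
have bound n : ('[u n, s] - L s) ^+ 2 <= '[s, s] * n.+1%:R^-1.
  have [Sn Jn] := uP n.
  apply: le_trans (_ : '[s, s] * (J (u n) - I) <= _); last first.
    by rewrite ler_wpM2l ?inner_ge0// lerBlDl ltW.
  apply: quadratic_ge0_discr => [|t]; first exact: inner_ge0.
  have : I <= J (t *: s + u n) by apply: JI; exact: Slin.
  rewrite -subr_ge0 /J Llin !norm_inner !innerDl !innerDr !innerZl !innerZr (innerC s).
  by congr (0 <= _); ring.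
have uL : '[u n, s] @[n --> \oo] --> '[m, s] by exact: cvg_inner.
suff /(cvg_lim (@Rhausdorff R)) : '[u n, s] @[n --> \oo] --> L s.
  by rewrite (cvg_lim (@Rhausdorff R) uL) innerC.
apply/cvgrPdist_le => e e0.
have e2 : 0 < e ^+ 2 / ('[s, s] + 1).
  by rewrite divr_gt0 ?exprn_gt0// ltr_wpDl// inner_ge0.
near=> n.
rewrite distrC -ler_sqr ?nnegrE ?(ltW e0)// real_normK ?num_real//.
apply: le_trans (bound n) _.
have un : n.+1%:R^-1 < e ^+ 2 / ('[s, s] + 1).
  by near: n; exact: near_infty_natSinv_lt (PosNum e2).
apply: le_trans (ler_wpM2l (inner_ge0 s) (ltW un)) _.
rewrite mulrCA ger_pMr ?exprn_gt0// ler_pdivrMr ?ltr_wpDl ?inner_ge0//.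
by rewrite mul1r lerDl.
Unshelve. all: by end_near. Qed.

End rkhs_inner.

Section weak_means.
Context (R : realType) (T : Type) (k : T -> T -> R) (H : @rkhs R T k).

Local Notation "'[ f , g ]" := (inner H f g).
Local Notation phi := (feature H).

Lemma inner_feature x y : '[phi x, phi y] = k x y.
Proof. by rewrite reproducing feature_eval. Qed.

Lemma inner_le_norm f (g : H) : `|g| <= 1 -> `|'[f, g]| <= `|f|.
Proof.
by move=> g1; apply: le_trans (norm_inner_le _ _) _; exact: ler_piMr.
Qed.

Definition weak_mean d' (E : measurableType d') (P : probability E R)
    (V : E -> H) (m : H) : Prop :=
  forall f, bmeas (fun e => '[f, V e]) /\ '[f, m] = \int[P]_e '[f, V e].

(** Riesz representation of the bounded functional sending [f] to the integral of ['[f, V e]]; only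
    scalar measurability of [V] is involved. *)
Lemma weak_mean_exists d' (E : measurableType d') (P : probability E R)
    (V : E -> H) : (forall f, bmeas (fun e => '[f, V e])) ->
  (forall e, `|V e| <= 1) -> exists m, weak_mean P V m.
Proof.
move=> bV V1.
have [||a f g|f|_ [m [_ _ mP]]] := @subspace_representer R T k H setT
  (fun f => \int[P]_e '[f, V e]) 1.
- by [].
- by [].
- rewrite -RintZ// -RintD//; last exact: bmeasZ.
  by apply: eq_Rintegral => e _; rewrite innerDl innerZl.
- by rewrite mul1r; apply: Rint_norm_le => // e; exact: inner_le_norm.
by exists m => f; split => //; exact: mP.
Qed.

Lemma weak_mean_inner d' (E : measurableType d') (P : probability E R)
    (V : E -> H) (m f : H) : weak_mean P V m ->
  '[f, m] = \int[P]_e '[f, V e].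
Proof. by move=> /(_ f)[]. Qed.

Lemma weak_mean_norm_le1 d' (E : measurableType d') (P : probability E R)
    (V : E -> H) (m : H) : weak_mean P V m -> (forall e, `|V e| <= 1) -> `|m| <= 1.
Proof.
move=> mP V1; have [bm mE] := mP m.
have : `|m| ^+ 2 <= `|m|.
  rewrite norm_inner mE; apply: le_trans (ler_norm _) _.
  by apply: Rint_norm_le => // e; exact: inner_le_norm.
rewrite expr2; have [->|m0] := eqVneq `|m| 0; first by rewrite ler01.
by rewrite ger_pMl// lt_neqAle eq_sym m0 /=.
Qed.

End weak_means.

Section mean_embeddings.
Context (R : realType) (d : measure_display) (T : measurableType d).
Context (k : T -> T -> R) (H : @rkhs R T k).
Hypothesis k_section : forall x, measurable_fun setT (k x).
Hypothesis k_diag : forall x, k x x <= 1.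

Local Notation "'[ f , g ]" := (inner H f g).
Local Notation phi := (feature H).

Lemma norm_feature_le1 x : `|phi x| <= 1.
Proof. by rewrite -(@expr_le1 _ 2)// norm_inner inner_feature. Qed.

(* The f with a measurable evaluation form a subspace containing every feature;
   representing <., f> on it gives an element with the same evaluations as f. *)
Lemma bmeas_inner_feature (f : H) : bmeas (fun x => '[f, phi x]).
Proof.
split; last by exists `|f| => x; exact/inner_le_norm/norm_feature_le1.
pose S := [set g : H | measurable_fun setT (fun x => '[g, phi x])].
have [||a g h|g|u [m [uS um mf]]] := @subspace_representer R T k H S (fun g => '[g, f]) `|f|.
- by rewrite /S /=; under eq_fun do rewrite inner0l; exact: measurable_cst.
- move=> a g h; rewrite /S /= => mg mh; under eq_fun do rewrite innerDl innerZl.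
  by apply: measurable_funD => //; apply: measurable_funM => //; exact: measurable_cst.
- by rewrite innerDl innerZl.
- by rewrite mulrC; exact: norm_inner_le.
have evalE x : '[f, phi x] = '[m, phi x].
  rewrite innerC [RHS]innerC mf// /S /=.
  by under eq_fun do rewrite inner_feature; exact: k_section.
under eq_fun do rewrite evalE.
apply: (measurable_fun_cvg (h := fun n x => '[u n, phi x])) => // x _.
exact: cvg_inner.
Qed.

Lemma is_expectation_unique (P : {measure set T -> \bar R}) (m : H) :
  is_expectation P phi m -> mean_embedding H P = m.
Proof.
move=> mP; apply: inner_inj => f.
have /(_ f)[_ ->] : is_expectation P phi (mean_embedding H P).
  by apply: getPex; exists m.
by have [_ ->] := mP f.
Qed.

Lemma weak_mean_is_expectation (P : probability T R) (m : H) :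
  weak_mean P phi m -> is_expectation P phi m.
Proof. by move=> mP f; have [bf fE] := mP f; split => //; exact: bmeas_integrable. Qed.

Lemma mean_embeddingP (P : probability T R) : weak_mean P phi (mean_embedding H P).
Proof.
have [m mP] := weak_mean_exists P bmeas_inner_feature norm_feature_le1.
by rewrite (is_expectation_unique (weak_mean_is_expectation mP)).
Qed.

End mean_embeddings.

(** Adding the bound [M] makes [f] nonnegative and shifts both sides equally. Formulas of Tonelli
    type thus pass to bounded functions of any sign. *)
Lemma Rint_of_ge0 (R : realType) d (T : measurableType d) (P : probability T R)
    (I : (T -> R) -> R) :
  (forall f (c : R), bmeas f -> I (fun x => f x + c) = I f + c) ->
  (forall f, bmeas f -> (forall x, 0 <= f x) ->
    (\int[P]_x (f x)%:E = (I f)%:E)%E) ->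
  forall f, bmeas f -> \int[P]_x f x = I f.
Proof.
move=> Ic I0 f bf; have [_ [M fM]] := bf.
have bfM : bmeas (fun x => f x + M) by apply: bmeasD => //; exact: bmeas_cst.
have f0 x : 0 <= f x + M by have := fM x; rewrite ler_norml => /andP[]; lra.
have := I0 _ bfM f0; rewrite -EFin_Rint// => -[].
rewrite RintD ?Rint_cst//; last exact: bmeas_cst.
by rewrite Ic// => /addIr.
Qed.

Section averages.
Context (R : realType) (d : measure_display) (T : measurableType d).
Context (m : nat -> probability T R) (n : nat).
Hypothesis n_gt0 : (0 < n)%N.

Let avgm := average_measure n (fun i => m i : {measure set T -> \bar R}).

Let avg : set T -> \bar R := avgm.

HB.instance Definition _ := isMeasure.Build _ _ _ avg (measure0 avgm)
  (measure_ge0 avgm) (@measure_semi_sigma_additive _ _ _ avgm).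

Let avgT : avg setT = 1%E.
Proof.
rewrite /avg /avgm /average_measure /= /mscale/= /msum/=.
under eq_bigr do rewrite probability_measure_setT.
rewrite sumEFin big_const_ord iter_addr_0 -EFinM mulVf//.
by rewrite pnatr_eq0 -lt0n.
Qed.

HB.instance Definition _ := Measure_isProbability.Build _ _ _ avg avgT.

Lemma Rint_average f : bmeas f ->
  \int[avgm]_x f x = n%:R^-1 * \sum_(i < n) \int[m i]_x f x.
Proof.
pose I f := n%:R^-1 * \sum_(i < n) \int[m i]_x f x.
have n0 : n%:R != 0 :> R by rewrite pnatr_eq0 -lt0n.
apply: (@Rint_of_ge0 _ _ _ avg I) => [{}f c bf|{}f bf f0]; rewrite /I.
  under eq_bigr do rewrite (RintD _ bf (bmeas_cst _ c)) Rint_cst.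
  rewrite big_split/= sumr_const card_ord mulrDr -[c *+ n]mulr_natl.
  by rewrite mulrA mulVf// mul1r.
have mf : measurable_fun setT (EFin \o f) by apply/measurable_EFinP; case: bf.
have f0' x : setT x -> (0 <= (f x)%:E)%E by rewrite lee_fin.
rewrite ge0_integral_mscale// ge0_integral_measure_sum//.
rewrite EFinM -sumEFin; congr (_ * _)%E.
by apply: eq_bigr => i _; rewrite EFin_Rint.
Qed.

Lemma bmeas_average_integrable f : bmeas f -> avgm.-integrable setT (EFin \o f).
Proof. exact: (bmeas_integrable avg). Qed.

End averages.

Lemma average_expectation (R : realType) d (T : measurableType d)
    (k : T -> T -> R) (H : @rkhs R T k) (m : nat -> probability T R)
    (e : nat -> H) (n : nat) : (0 < n)%N ->
  (forall i, weak_mean (m i) (feature H) (e i)) ->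
  is_expectation (average_measure n (fun i => m i : {measure set T -> \bar R}))
    (feature H) (n%:R^-1 *: \sum_(i < n) e i).
Proof.
move=> n0 me f; split.
  by apply: bmeas_average_integrable => //; case: (me 0%N f).
rewrite Rint_average//; last by case: (me 0%N f).
rewrite innerZr inner_sumr; congr (_ * _); apply: eq_bigr => i _.
exact: weak_mean_inner.
Qed.

(** * The model *)

Lemma measurable_fun_xsection_probability (R : realType)
    (d1 d2 : measure_display) (X : measurableType d1) (Y : measurableType d2)
    (Q : X -> probability Y R) (A : set (X * Y)) :
  (forall B : set Y, measurable B -> measurable_fun [set: X] (fun x => Q x B)) ->
  measurable A -> measurable_fun [set: X] (fun x => Q x (xsection A x)).
Proof.
move=> mQ mA.
have bA : bmeas (\1_A : X * Y -> R).
  split; first exact: measurable_indic.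
  by exists 1 => q; rewrite ger0_norm// indicE lern1 leq_b1.
rewrite (_ : (fun x => _) = (fun x => (\int[Q x]_y (\1_A (x, y)))%:E)).
  by apply/measurable_EFinP; case: (bmeas_Rint mQ bA).
apply/funext => x; rewrite /Rintegral (_ : (\int[Q x]_y _)%E = Q x (xsection A x)).
  by rewrite fineK// fin_num_measure//; exact: measurable_xsection.
transitivity (\int[Q x]_y (\1_(xsection A x) y)%:E)%E.
  by apply: eq_integral => y _; rewrite !indicE mem_xsection.
by rewrite integral_indic ?setIT//; exact: measurable_xsection.
Qed.

Section joint_integral.
Context (R : realType) (d1 d2 : measure_display).
Context (X : measurableType d1) (Y : measurableType d2).
Context (PX : probability X R) (Q : X -> probability Y R).
Context (mQ : forall A : set Y, measurable A ->
  measurable_fun [set: X] (fun x => Q x A)).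

Let fibre x : probability (X * Y)%type R := (\d_x \x Q x)%E.

Let fibreE x (S : set (X * Y)) : measurable S -> fibre x S = Q x (xsection S x).
Proof.
move=> mS; rewrite /fibre /= /product_measure1 integral_dirac//; last first.
  by apply: measurable_fun_xsection.
by rewrite diracT mul1e.
Qed.

Lemma ge0_fibre_integral (F : X * Y -> \bar R) x : measurable_fun setT F ->
  (forall q, 0 <= F q)%E ->
  (\int[(\d_x \x Q x)%E]_q F q = \int[Q x]_y F (x, y))%E.
Proof.
move=> mF F0; rewrite fubini_tonelli1// integral_dirac//; last first.
  exact: measurable_fun_fubini_tonelli_F.
by rewrite diracT mul1e.
Qed.

(** [joint PX mQ] is recognised as the composition of the constant kernel [PX] on a one-point space
    with the kernel of the fibre laws, so its integrals become iterated ones. *)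
Let base (_ : unit) : {measure set X -> \bar R} := PX.
Let mbase (A : set X) : measurable A -> measurable_fun [set: unit] (base ^~ A).
Proof. by move=> mA; exact: measurable_cst. Qed.
HB.instance Definition _ := isKernel.Build _ _ _ _ _ base mbase.
Let base1 u : base u setT = 1%E. Proof. exact: probability_setT. Qed.
HB.instance Definition _ := Kernel_isProbability.Build _ _ _ _ _ base base1.

Let fib (p : unit * X) : {measure set (X * Y) -> \bar R} := fibre p.2.
Let mfib (A : set (X * Y)) : measurable A ->
  measurable_fun [set: unit * X] (fib ^~ A).
Proof.
move=> mA; rewrite /fib; under eq_fun do rewrite fibreE//.
apply: (@measurableT_comp _ _ _ _ _ _ (fun x => Q x (xsection A x))) => //.
exact: measurable_fun_xsection_probability.
Qed.
HB.instance Definition _ := isKernel.Build _ _ _ _ _ fib mfib.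
Let fib1 p : fib p setT = 1%E. Proof. exact: probability_setT. Qed.
HB.instance Definition _ := Kernel_isProbability.Build _ _ _ _ _ fib fib1.

Lemma ge0_joint_integral (F : X * Y -> \bar R) : measurable_fun setT F ->
  (forall q, 0 <= F q)%E ->
  (\int[joint PX mQ]_q F q = \int[PX]_x \int[Q x]_y F (x, y))%E.
Proof.
move=> mF F0.
pose m1 : {measure set (X * Y) -> \bar R} := joint PX mQ.
pose m2 : {measure set (X * Y) -> \bar R} := mkcomp base fib tt.
have -> : (\int[joint PX mQ]_q F q = \int[m2]_q F q)%E.
  apply: (@eq_measure_integral _ _ _ setT m2 m1) => A mA _.
  by apply: eq_integral => x _; rewrite /fib fibreE.
rewrite [LHS]integral_kcomp//; apply: eq_integral => x _.
exact: ge0_fibre_integral.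
Qed.

End joint_integral.

Section bounded_joint_integral.
Context (R : realType) (d1 d2 : measure_display).
Context (X : measurableType d1) (Y : measurableType d2).
Context (PX : probability X R) (Q : X -> probability Y R).
Context (mQ : forall A : set Y, measurable A ->
  measurable_fun [set: X] (fun x => Q x A)).

Lemma bmeas_pair (f : X * Y -> R) x : bmeas f -> bmeas (fun y => f (x, y)).
Proof. by move=> [mf [M fM]]; split; [exact: measurable_fun_pair2|exists M]. Qed.

Lemma Rint_fibre (f : X * Y -> R) x : bmeas f ->
  \int[(\d_x \x Q x)%E]_q f q = \int[Q x]_y f (x, y).
Proof.
apply: (@Rint_of_ge0 _ _ _ (\d_x \x Q x)%E (fun f => \int[Q x]_y f (x, y)))
  => [{}f c bf|{}f bf f0].
  by rewrite RintD ?Rint_cst//; [exact: bmeas_pair|exact: bmeas_cst].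
rewrite ge0_fibre_integral//; first by rewrite EFin_Rint//; exact: bmeas_pair.
by apply/measurable_EFinP; case: bf.
Qed.

Lemma Rint_joint (f : X * Y -> R) : bmeas f ->
  \int[joint PX mQ]_q f q = \int[PX]_x \int[Q x]_y f (x, y).
Proof.
apply: (@Rint_of_ge0 _ _ _ (joint PX mQ) (fun f => \int[PX]_x \int[Q x]_y f (x, y)))
  => [{}f c bf|{}f bf f0].
  under eq_Rintegral do rewrite (RintD _ (bmeas_pair _ bf) (bmeas_cst _ c)) Rint_cst.
  by rewrite RintD ?Rint_cst//; [exact: bmeas_Rint|exact: bmeas_cst].
rewrite ge0_joint_integral//; last by apply/measurable_EFinP; case: bf.
rewrite EFin_Rint; last exact: bmeas_Rint.
by apply: eq_integral => x _; rewrite EFin_Rint//; exact: bmeas_pair.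
Qed.

End bounded_joint_integral.

Section hilbert_discrepancy.
Context (R : realType) (T : Type) (k : T -> T -> R) (H : @rkhs R T k).
Local Notation "'[ f , g ]" := (inner H f g).

Lemma kform_inner (E : Type) (V : E -> H) (s : seq (R * E)) :
  kform (fun x y => '[V x, V y]) s = `|\sum_(p <- s) p.1 *: V p.2| ^+ 2.
Proof.
rewrite norm_inner inner_suml; apply: eq_bigr => p _.
by rewrite inner_sumr; apply: eq_bigr => q _; rewrite innerZl innerZr mulrA.
Qed.

Lemma sum_sample (E : Type) (M : nmodType) (F : R * E -> M) (x : nat -> E) n :
  \sum_(p <- sample R x n) F p = \sum_(i < n) F (1, x i).
Proof.
elim: n => [|n IHn]; first by rewrite big_nil big_ord0.
by rewrite big_cons IHn big_ord_recr/= addrC.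
Qed.

(** The centred kernel is the Gram kernel of [V - m], so its form on the sample is the squared norm
    of the centred sum. This carries the kernel bounds over to [H]. *)
Lemma norm_mean_discrepancy d (E : measurableType d) (P : probability E R)
    (V : E -> H) (m : H) (K : E -> E -> R) (n : nat) (x : nat -> E) :
  (0 < n)%N -> weak_mean P V m -> (forall y z, K y z = '[V y, V z]) ->
  `|n%:R^-1 *: (\sum_(i < n) V (x i)) - m| = discrepancy P K n x.
Proof.
move=> n0 Pm KE.
have meanE y : kmean P K y = '[V y, m].
  by rewrite (weak_mean_inner _ Pm); apply: eq_Rintegral => z _; rewrite KE.
have mean2E : kmean2 P K = '[m, m].
  rewrite [RHS](weak_mean_inner _ Pm); apply: eq_Rintegral => z _.
  by rewrite meanE innerC.
have centreE : kcentre P K = fun y z => '[V y - m, V z - m].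
  apply/funext => y; apply/funext => z.
  by rewrite /kcentre !meanE mean2E KE innerBl !innerBr (innerC m); ring.
rewrite /discrepancy centreE kform_inner sqrtr_sqr normr_id.
rewrite (sum_sample (fun p => p.1 *: (V p.2 - m))) /=.
under [X in _ = `|X| / _]eq_bigr do rewrite scale1r.
have n0R : n%:R != 0 :> R by rewrite pnatr_eq0 -lt0n.
have -> : n%:R^-1 *: (\sum_(i < n) V (x i)) - m = n%:R^-1 *: \sum_(i < n) (V (x i) - m).
  rewrite sumrB scalerBr sumr_const card_ord -[m *+ n]scaler_nat.
  by rewrite scalerA mulVf// scale1r.
by rewrite normrZ ger0_norm ?invr_ge0// mulrC.
Qed.

Lemma contamination_le (E : Type) (V : E -> H) (eps : R) n (z z0 : nat -> E) :
  (0 < n)%N -> (forall e, `|V e| <= 1) -> adversarial_contamination eps n z z0 ->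
  `|n%:R^-1 *: (\sum_(i < n) V (z i)) - n%:R^-1 *: (\sum_(i < n) V (z0 i))| <= 2 * eps.
Proof.
move=> n0 V1 [I Ie zz0]; rewrite -scalerBr -sumrB normrZ ger0_norm ?invr_ge0//.
apply: le_trans (_ : 2 * (#|I|%:R / n%:R) <= _); last by rewrite ler_wpM2l.
rewrite mulrA [leRHS]mulrC ler_wpM2l ?invr_ge0//.
rewrite (bigID (mem I))/= [X in _ + X]big1 ?addr0; last first.
  by move=> i iI; rewrite zz0// subrr.
apply: le_trans (ler_norm_sum _ _ _) _.
apply: le_trans (_ : \sum_(i in I) 2 <= _).
  apply: ler_sum => i _; apply: le_trans (ler_normB _ _) _.
  by have := V1 (z i); have := V1 (z0 i); lra.
by rewrite sumr_const -[2 *+ _]mulr_natr.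
Qed.

End hilbert_discrepancy.

Section model_embedding.
Context (R : realType) (d1 d2 : measure_display).
Context (X : measurableType d1) (Y : measurableType d2).
Context (kX : X -> X -> R) (kY : Y -> Y -> R).
Context (HX : @rkhs R X kX) (HY : @rkhs R Y kY).
Context (H : @rkhs R (X * Y)%type (tensor_kernel kX kY)).
Hypothesis kX_meas : bmeas2 kX.
Hypothesis kY_meas : bmeas2 kY.
Hypothesis kX_le1 : forall x y, `|kX x y| <= 1.
Hypothesis kY_le1 : forall x y, `|kY x y| <= 1.
Context (Q : X -> probability Y R).
Hypothesis mQ : forall A : set Y, measurable A ->
  measurable_fun [set: X] (fun x => Q x A).

Local Notation "'[ f , g ]" := (inner H f g).

Lemma bmeas2_tensor : bmeas2 (tensor_kernel kX kY).
Proof.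
apply: bmeasM.
- apply: (bmeas2_comp (u := fun q : (X * Y) * (X * Y) => q.1.1) (v := fun q => q.2.1)) => //.
  + exact: measurableT_comp.
  + exact: measurableT_comp.
- apply: (bmeas2_comp (u := fun q : (X * Y) * (X * Y) => q.1.2) (v := fun q => q.2.2)) => //.
  + exact: measurableT_comp.
  + exact: measurableT_comp.
Qed.

Lemma tensor_section z : measurable_fun setT (tensor_kernel kX kY z).
Proof. by case: (bmeas2_sectionr z bmeas2_tensor). Qed.

Lemma tensor_diag z : tensor_kernel kX kY z z <= 1.
Proof.
apply: le_trans (ler_norm _) _.
by rewrite /tensor_kernel normrM mulr_ile1.
Qed.

Lemma kY_section y : measurable_fun setT (kY y).
Proof. by case: (bmeas2_sectionr y kY_meas). Qed.

Lemma kY_diag y : kY y y <= 1.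
Proof. exact: le_trans (ler_norm _) (kY_le1 _ _). Qed.

Definition fibre_embedding x : H := mean_embedding H (\d_x \x Q x)%E.

Lemma fibre_embeddingP x :
  weak_mean ((\d_x \x Q x)%E : probability _ R) (feature H) (fibre_embedding x).
Proof. exact: mean_embeddingP tensor_section tensor_diag _. Qed.

Lemma fibre_embedding_norm_le1 x : `|fibre_embedding x| <= 1.
Proof.
by apply: weak_mean_norm_le1 (fibre_embeddingP x) _ => z; exact/norm_feature_le1/tensor_diag.
Qed.

Lemma bmeas_eval (f : H) : bmeas (fun z => '[f, feature H z]).
Proof. exact: bmeas_inner_feature tensor_section tensor_diag f. Qed.

Lemma inner_fibre_embedding (f : H) x :
  '[f, fibre_embedding x] = \int[Q x]_y '[f, feature H (x, y)].
Proof.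
by rewrite (weak_mean_inner _ (fibre_embeddingP x)) Rint_fibre//; exact: bmeas_eval.
Qed.

Lemma bmeas_inner_fibre_embedding (f : H) : bmeas (fun x => '[f, fibre_embedding x]).
Proof.
under eq_fun do rewrite inner_fibre_embedding.
refine (bmeas_Rint mQ (bmeas_eval f)).
Qed.

Lemma joint_weak_mean (PX : probability X R) :
  weak_mean PX fibre_embedding (mean_embedding H (joint PX mQ)).
Proof.
move=> f; split; first exact: bmeas_inner_fibre_embedding.
have /weak_mean_inner -> := mean_embeddingP (H := H) tensor_section tensor_diag (joint PX mQ).
rewrite Rint_joint; last exact: bmeas_eval.
by apply: eq_Rintegral => x _; rewrite inner_fibre_embedding.
Qed.

(** The Gram kernel of the fibre embeddings ([fibre_kernelE]), kept factored because the conditional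
    mean operators act on the second factor. *)
Definition fibre_kernel x x' : R :=
  kX x x' * inner HY (mean_embedding HY (Q x)) (mean_embedding HY (Q x')).

Lemma inner_mean_embeddingY (P P' : probability Y R) :
  inner HY (mean_embedding HY P) (mean_embedding HY P') =
  \int[P']_y \int[P]_y' kY y y' :> R.
Proof.
have mP := mean_embeddingP (H := HY) kY_section kY_diag P.
have mP' := mean_embeddingP (H := HY) kY_section kY_diag P'.
rewrite (weak_mean_inner _ mP'); apply: eq_Rintegral => y _.
rewrite innerC (weak_mean_inner _ mP); apply: eq_Rintegral => y' _.
by rewrite inner_feature.
Qed.

Lemma fibre_kernelE x x' :
  fibre_kernel x x' = '[fibre_embedding x, fibre_embedding x'].
Proof.
rewrite inner_fibre_embedding.
rewrite /fibre_kernel inner_mean_embeddingY -RintZ; last first.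
  exact: (@bmeas_RintP _ _ _ _ _ (Q x) (fun q => kY q.1 q.2) kY_meas).
apply: eq_Rintegral => y _; rewrite innerC inner_fibre_embedding -RintZ; last first.
  exact: bmeas2_sectionr.
apply: eq_Rintegral => y' _; rewrite inner_feature /tensor_kernel/=.
(* This reads the symmetry of [kX] off the inner product of [HX]. *)
have := inner_feature HX x x'; rewrite innerC inner_feature => ->.
by [].
Qed.

(** Scalar measurability of the embeddings does not by itself give joint measurability of their
    inner product without separability. That product is instead a double integral of [kY], handled
    one variable at a time by [bmeas_Rint]. *)
Lemma bmeas2_fibre_kernel : bmeas2 fibre_kernel.
Proof.
apply: bmeasM => //.
pose h (p : Y * X) : R := \int[Q p.2]_y' kY p.1 y'.
have bh : bmeas h.
  apply: (@bmeas_Rint _ _ _ (Y * X)%type Y (fun p => Q p.2) _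
    (fun q : (Y * X) * Y => kY q.1.1 q.2)).
    by move=> A mA; exact: (measurableT_comp (mQ mA) measurable_snd).
  apply: (bmeas2_comp (u := fun q : (Y * X) * Y => q.1.1) (v := fun q => q.2)) => //.
    exact: measurableT_comp.
  exact: measurable_snd.
suff : bmeas (fun q : X * X => \int[Q q.2]_y h (y, q.1)).
  by congr bmeas; apply/funext => q; rewrite inner_mean_embeddingY.
apply: (@bmeas_Rint _ _ _ (X * X)%type Y (fun p => Q p.2) _
  (fun q : (X * X) * Y => h (q.2, q.1.1))).
  by move=> A mA; exact: (measurableT_comp (mQ mA) measurable_snd).
have [mh [M hM]] := bh; split; last by exists M => q; exact: hM.
apply: (measurableT_comp mh (g := fun q : (X * X) * Y => (q.2, q.1.1))).
apply: measurable_fun_pair; first exact: measurable_snd.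
exact: measurableT_comp.
Qed.

Lemma fibre_kernel_le1 x x' : `|fibre_kernel x x'| <= 1.
Proof.
rewrite fibre_kernelE; apply: le_trans (norm_inner_le _ _) _.
by rewrite mulr_ile1// fibre_embedding_norm_le1.
Qed.

Lemma fibre_kernel_is_kernel : is_kernel fibre_kernel.
Proof.
apply/is_kernelP; split=> [x y|s]; first by rewrite !fibre_kernelE innerC.
rewrite (_ : fibre_kernel = (fun x y => '[fibre_embedding x, fibre_embedding y])).
  by rewrite kform_inner sqr_ge0.
by apply/funext => x; apply/funext => y; rewrite fibre_kernelE.
Qed.

(* c ^+ 2 <k x, k x'> - <C k x, C k x'> is a kernel in (x, x'), hence so is its
   product with kX. *)
Lemma fibre_kernel_domination (C : {linear HX -> HY}) (c : R) :
  is_kernel kX -> 0 <= c -> (forall f, `|C f| <= c * `|f|) ->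
  (forall x, C (feature HX x) = mean_embedding HY (Q x)) ->
  is_kernel (fun x y => c ^+ 2 * (kX x y * kX x y) - fibre_kernel x y).
Proof.
move=> kXker c0 Cc CQ.
pose D x y := c ^+ 2 * kX x y - inner HY (C (feature HX x)) (C (feature HX y)).
have Dker : is_kernel D.
  apply/is_kernelP; split=> [x y|s]; first by rewrite /D (kXker.1 x) innerC.
  have -> : kform D s = c ^+ 2 * kform (fun x y => inner HX (feature HX x) (feature HX y)) s
      + (-1) * kform (fun x y => inner HY (C (feature HX x)) (C (feature HX y))) s.
    rewrite -!kformZ -kformD; apply: eq_bigr => p _; apply: eq_bigr => q _.
    by rewrite /D inner_feature; ring.
  rewrite (kform_inner (feature HX)) (kform_inner (C \o feature HX)).
  have -> : \sum_(p <- s) p.1 *: (C \o feature HX) p.2 = C (\sum_(p <- s) p.1 *: feature HX p.2).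
    by rewrite linear_sum; apply: eq_bigr => p _; rewrite linearZ.
  set v := \sum_(p <- s) _; rewrite mulN1r subr_ge0 -exprMn.
  by rewrite ler_sqr ?nnegrE ?mulr_ge0.
rewrite (_ : (fun x y => _) = (fun x y => kX x y * D x y)); first exact: schur_product.
apply/funext => x; apply/funext => y.
by rewrite /D /fibre_kernel !CQ; ring.
Qed.

End model_embedding.

(* The [x_i] and [y_i] are the distances in the chain of triangle inequalities of
   [mmd_excess_le]. *)
Lemma excess_arith (R : realType) (x1 x2 x3 x4 x5 x6 x7 x8 x9 y1 y2 y3 y4 y5 y6
    A w eps : R) :
  x1 <= x2 + x3 -> x3 <= x4 + x5 -> x5 <= x6 + x7 -> x7 <= x8 + x9 ->
  x6 <= y1 -> y1 <= y2 + y3 -> y3 <= y4 + y5 -> y5 <= y6 + A ->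
  A <= x9 + x8 -> x2 <= w -> x4 <= 2 * eps -> y2 <= 2 * eps -> x8 <= 2 * eps ->
  x1 - y6 <= 8 * eps + w + y4 + 2 * x9.
Proof. by lra. Qed.

Section empirical_embeddings.
Context (R : realType) (d1 d2 : measure_display).
Context (X : measurableType d1) (Y : measurableType d2).
Context (kX : X -> X -> R) (kY : Y -> Y -> R).
Context (HX : @rkhs R X kX) (HY : @rkhs R Y kY).
Context (H : @rkhs R (X * Y)%type (tensor_kernel kX kY)).
Hypothesis kX_kernel : is_kernel kX.
Hypothesis kX_meas : bmeas2 kX.
Hypothesis kY_meas : bmeas2 kY.
Hypothesis kX_le1 : forall x y, `|kX x y| <= 1.
Hypothesis kY_le1 : forall x y, `|kY x y| <= 1.

Let bmeas_evalH (f : H) : bmeas (fun z => inner H f (feature H z)).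
Proof. exact: bmeas_eval. Qed.

Lemma empirical_embedding n (z : nat -> X * Y) : (0 < n)%N ->
  mean_embedding H (empirical R n z) = n%:R^-1 *: \sum_(i < n) feature H (z i).
Proof.
move=> n0; apply: is_expectation_unique.
apply: (@average_expectation _ _ _ _ H (fun i => \d_(z i) : probability _ R)
  (fun i => feature H (z i)) n n0) => i f; split; first exact: bmeas_evalH.
rewrite /Rintegral integral_dirac//; first by rewrite diracT mul1e.
by apply/measurable_EFinP; case: (bmeas_evalH f).
Qed.

Lemma empirical_model_embedding (Q : X -> probability Y R) n (x : nat -> X) :
  (0 < n)%N -> mean_embedding H (empirical_model Q n x) =
  n%:R^-1 *: \sum_(i < n) fibre_embedding H Q (x i).
Proof.
move=> n0; apply: is_expectation_unique.
apply: (@average_expectation _ _ _ _ H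
  (fun i => (\d_(x i) \x Q (x i))%E : probability _ R)
  (fun i => fibre_embedding H Q (x i)) n n0) => i.
exact: fibre_embeddingP.
Qed.

Context (Theta : Type) (Q : Theta -> X -> probability Y R).
Hypothesis mQ : forall theta (A : set Y), measurable A ->
  measurable_fun [set: X] (fun x => Q theta x A).
Context (C : Theta -> {linear HX -> HY}) (c : R).
Hypothesis c_ge0 : 0 <= c.
Hypothesis C_le : forall theta f, `|C theta f| <= c * `|f|.
Hypothesis C_cme : forall theta, is_cme (Q theta) (C theta).
Context (P0 : probability (X * Y)%type R) (PX : probability X R).

Local Notation D theta := (mmd H (joint PX (mQ theta)) P0).

(** A deterministic bound: [thetahat] enters only through its minimality on the contaminated data.
    The empirical law is traversed once on each side of that comparison, whence the factor 2. *)
Lemma mmd_excess_le (n : nat) (eps : R) (z z0 : nat -> X * Y) (theta0 thetahat : Theta) :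
  (0 < n)%N -> adversarial_contamination eps n z z0 ->
  is_argmin (fun theta => mmd H (empirical_model (Q theta) n (fun i => (z i).1))
    (empirical R n z) ^+ 2) thetahat ->
  D thetahat - D theta0 <= 8 * eps
    + c * discrepancy PX (fun x y => kX x y * kX x y) n (fst \o z0)
    + discrepancy PX (fibre_kernel kX HY (Q theta0)) n (fst \o z0)
    + 2 * discrepancy P0 (tensor_kernel kX kY) n z0.
Proof.
move=> n0 cont amin.
pose a theta (y : nat -> X * Y) : H :=
  n%:R^-1 *: (\sum_(i < n) fibre_embedding H (Q theta) (y i).1).
pose b (y : nat -> X * Y) : H := n%:R^-1 *: (\sum_(i < n) feature H (y i)).
have aE theta : mean_embedding H (empirical_model (Q theta) n (fun i => (z i).1)) = a theta z.
  exact: empirical_model_embedding.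
have bE : mean_embedding H (empirical R n z) = b z by exact: empirical_embedding.
have ab : `|a thetahat z - b z| <= `|a theta0 z - b z|.
  have := amin theta0; rewrite /mmd !aE bE.
  by rewrite ler_sqr ?nnegrE.
have a_cont theta : `|a theta z - a theta z0| <= 2 * eps.
  apply: (contamination_le (V := fun q => fibre_embedding H (Q theta) q.1)) => // q.
  exact: fibre_embedding_norm_le1.
have b_cont : `|b z - b z0| <= 2 * eps.
  by apply: contamination_le => // q; apply: norm_feature_le1 => q'; exact: tensor_diag.
pose p theta := mean_embedding H (joint PX (mQ theta)); pose p0 := mean_embedding H P0.
have aD theta : `|a theta z0 - p theta| =
    discrepancy PX (fibre_kernel kX HY (Q theta)) n (fst \o z0).
  apply: (norm_mean_discrepancy (V := fibre_embedding H (Q theta)) (fst \o z0)) => //.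
    exact: joint_weak_mean.
  by move=> y y'; exact: fibre_kernelE.
have bD : `|b z0 - p0| = discrepancy P0 (tensor_kernel kX kY) n z0.
  apply: norm_mean_discrepancy => //; last by move=> y y'; rewrite inner_feature.
  by apply: mean_embeddingP => q; [exact: tensor_section|exact: tensor_diag].
have a_le : `|a thetahat z0 - p thetahat| <=
    c * discrepancy PX (fun x y => kX x y * kX x y) n (fst \o z0).
  rewrite aD; apply: le_discrepancy => //.
  - exact: schur_product.
  - exact: bmeasM.
  - by apply: bmeas2_fibre_kernel => //; exact: mQ.
  - exact: (fibre_kernel_domination kX_kernel c_ge0 (C_le thetahat) (C_cme thetahat)).
rewrite -aD -bD.
have tri (u v w : H) : `|u - w| <= `|u - v| + `|v - w| by exact: ler_distD.
have h1 := tri (p thetahat) (a thetahat z0) p0.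
have h2 := tri (a thetahat z0) (a thetahat z) p0.
have h3 := tri (a thetahat z) (b z) p0.
have h4 := tri (b z) (b z0) p0.
have h5 := tri (a theta0 z) (a theta0 z0) (b z).
have h6 := tri (a theta0 z0) (p theta0) (b z).
have h7 := tri (p theta0) p0 (b z).
have h8 := tri p0 (b z0) (b z).
have k1 := a_cont thetahat; have k0 := a_cont theta0.
rewrite (distrC (p thetahat) (a thetahat z0)) in h1.
rewrite (distrC (a thetahat z0) (a thetahat z)) in h2.
rewrite (distrC p0 (b z0)) (distrC (b z0) (b z)) in h8.
rewrite /mmd -/(p thetahat) -/(p theta0) -/p0.
exact: excess_arith h1 h2 h3 h4 ab h5 h6 h7 h8 a_le k1 k0 b_cont.
Qed.

End empirical_embeddings.

(** * Tail bounds for the estimator *)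

Section limsup.
Context (R : realType) (d : measure_display) (W : measurableType d).
Context (Pr : probability W R) (D : nat -> W -> R) (L : R).
Hypothesis D_meas : forall n, (0 < n)%N -> measurable_fun setT (D n).
Hypothesis D_tail : forall delta, 0 < delta -> exists (N : nat) (c : R), 0 < c /\
  forall n, (N <= n)%N ->
    (Pr [set w | (L + delta <= D n w)%R] <= (8 * expR (- (c * n%:R)))%:E)%E.

(** [D 0] is not assumed measurable; making its event empty does not affect the limit superior. *)
Let exceed delta n : set W :=
  if (0 < n)%N then [set w | L + delta <= D n w] else set0.

Let exceed_meas delta n : measurable (exceed delta n).
Proof.
rewrite /exceed; case: ifPn => // n0.
have mD := D_meas n0; have := mD measurableT `[L + delta, +oo[%classic (measurable_itv _).
by rewrite setTI; congr measurable; apply/seteqP; split=> w /=; rewrite in_itv/= andbT.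
Qed.

Let limsup_exceed delta : 0 < delta -> Pr (lim_sup_set (exceed delta)) = 0%E.
Proof.
move=> delta0; have [N [c [c0 tail]]] := D_tail delta0.
(* Dropping the indices below [N], where no tail bound is given, leaves the limsup set unchanged and
   makes the probabilities summable against a geometric series. *)
pose F n := if (N <= n)%N then exceed delta n else set0.
have -> : lim_sup_set (exceed delta) = lim_sup_set F.
  apply/seteqP; split=> w h n _.
    have [j /= nNj ej] := h (maxn n N) I.
    rewrite geq_max in nNj; have [nj Nj] := andP nNj.
    by exists j => //; rewrite /F Nj.
  have [j nj] := h n I; rewrite /F; case: ifPn => // _ ej.
  by exists j.
apply: lim_sup_set_cvg0 => [n|]; first by rewrite /F; case: ifP.
pose r := expR (- c).
have r1 : `|r| < 1 by rewrite ger0_norm ?expR_ge0// expR_lt1 oppr_lt0.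
have FE n : (Pr (F n) <= (geometric 8 r n)%:E)%E.
  rewrite /F; case: ifPn => [Nn|_]; last first.
    by rewrite measure0 lee_fin geometric_ge0// expR_ge0.
  rewrite /exceed; case: ifPn => _; last first.
    by rewrite measure0 lee_fin geometric_ge0// expR_ge0.
  apply: le_trans (tail n Nn) _; rewrite lee_fin /geometric /= /r -expRM_natl.
  by rewrite mulrN [_ * c]mulrC.
apply: (@le_lt_trans _ _ (\sum_(n <oo) (geometric 8 r n)%:E)%E).
  by apply: lee_nneseries => // n _; exact: FE.
have : (\sum_(0 <= i < n) (geometric 8 r i)%:E)%E @[n --> \oo] --> (8 * (1 - r)^-1)%:E.
  under eq_fun do rewrite sumEFin.
  by apply: cvg_EFin; [exact: nearW|exact: cvg_geometric_series].
by move=> /cvg_lim -> //; exact: ltry.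
Qed.

(** The limit superior exceeds [L] exactly when, for some [m], the sequence is at least
    [L + m.+1%:R^-1] infinitely often; this is a countable union of null events. *)
Lemma limn_esup_le_prob1 :
  Pr [set w | (limn_esup (fun n => (D n w)%:E) <= L%:E)%E] = 1%E.
Proof.
have inv0 (m : nat) : 0 < m.+1%:R^-1 :> R by rewrite invr_gt0 ltr0n.
pose N m := lim_sup_set (exceed m.+1%:R^-1).
have mN m : measurable (N m).
  apply: bigcap_measurable => // n _.
  by apply: bigcup_measurable => j _.
have -> : [set w | (limn_esup (fun n => (D n w)%:E) <= L%:E)%E] = ~` \bigcup_m N m.
  rewrite setC_bigcup; apply/seteqP; split=> w /=; rewrite limn_esup_lim.
    rewrite (cvg_lim _ (@cvg_esups_inf _ _))// => h m _ Nw.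
    have : (ereal_inf (range (esups (fun n => (D n w)%:E))) < (L + m.+1%:R^-1)%:E)%E.
      by apply: le_lt_trans h _; rewrite lte_fin ltrDl.
    move=> /ereal_inf_lt[_ [n _ <-] hn].
    have [j /= nj] := Nw n I; rewrite /exceed; case: ifPn => // _ /=.
    rewrite leNgt => /negP; apply; rewrite -lte_fin; apply: le_lt_trans hn.
    by apply: ereal_sup_ubound; exists j.
  move=> h; apply/lee_addgt0Pr => e e0.
  have [m me] : exists m : nat, m.+1%:R^-1 < e.
    have [m _ /(_ m (leqnn m))] := near_infty_natSinv_lt (PosNum e0).
    by exists m.
  have /existsNP[n /not_implyP[_ hn]] := h m I.
  rewrite (cvg_lim _ (@cvg_esups_inf _ _))//.
  (* Starting at [n.+1] keeps all indices positive, where [exceed] is the actual event. *)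
  apply: (@le_trans _ _ (esups (fun n => (D n w)%:E) n.+1)).
    by apply: ereal_inf_lbound; exists n.+1.
  apply: ge_ereal_sup => _ [j /= nj <-].
  rewrite -EFinD lee_fin; apply: le_trans (_ : L + m.+1%:R^-1 <= _); last first.
    by rewrite lerD2l ltW.
  rewrite leNgt; apply/negP => Dj; apply: hn; exists j => /=; first exact: ltnW.
  by rewrite /exceed (leq_trans _ nj)//= ltW.
have N0 : Pr (\bigcup_m N m) = 0%E.
  apply/eqP; rewrite eq_le measure_ge0 andbT.
  have mU : measurable (\bigcup_m N m) by exact: bigcup_measurable.
  apply: le_trans (measure_sigma_subadditive Pr mN mU (@subset_refl _ _)) _.
  by rewrite eseries0// => m _ _; exact: limsup_exceed.
rewrite probability_setC ?N0 ?sube0//; exact: bigcup_measurable.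
Qed.

End limsup.

Section union_bound.
Context (R : realType) (d : measure_display) (W : measurableType d).
Context (Pr : probability W R).

Lemma union_bound3 (A1 A2 A3 G : set W) (a : R) :
  measurable A1 -> measurable A2 -> measurable A3 -> measurable G ->
  (Pr A1 <= a%:E)%E -> (Pr A2 <= a%:E)%E -> (Pr A3 <= a%:E)%E ->
  ~` (A1 `|` A2 `|` A3) `<=` G -> ((1 - 3 * a)%:E <= Pr G)%E.
Proof.
move=> m1 m2 m3 mG a1 a2 a3 AG.
have m12 : measurable (A1 `|` A2) by exact: measurableU.
have m123 : measurable (A1 `|` A2 `|` A3) by exact: measurableU.
have UA : (Pr (A1 `|` A2 `|` A3) <= (3 * a)%:E)%E.
  apply: le_trans (measureU2 Pr m12 m3) _.
  have -> : 3 * a = a + a + a by ring.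
  rewrite !EFinD; apply: leeD => //.
  by apply: le_trans (measureU2 Pr m1 m2) _; exact: leeD.
apply: (@le_trans _ _ (Pr (~` (A1 `|` A2 `|` A3)))); last first.
  by apply: le_measure => //; rewrite inE//; exact: measurableC.
rewrite probability_setC// EFinB; exact: leeB.
Qed.

End union_bound.

Section tail_bounds.
Context (R : realType) (d : measure_display) (W : measurableType d).
Context (Pr : probability W R) (A E B D : nat -> W -> R).
Context (alpha c eps mu : R).
Hypothesis alpha_gt0 : 0 < alpha.
Hypothesis c_ge0 : 0 <= c.
Hypothesis mu_gt0 : 0 < mu.
Hypothesis eps_lt : eps < alpha / 64.
Hypothesis A_meas : forall n, measurable_fun setT (A n).
Hypothesis E_meas : forall n, measurable_fun setT (E n).
Hypothesis B_meas : forall n, measurable_fun setT (B n).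
Hypothesis D_meas : forall n, (0 < n)%N -> measurable_fun setT (D n).

Let tail (F : nat -> W -> R) := forall (n : nat) (t : R), (0 < n)%N -> 0 <= t ->
  (Pr [set w | ((Num.sqrt n%:R)^-1 * (1 + t) <= F n w)%R] <=
   (expR (- (t ^+ 2 / 2)))%:E)%E.

Hypothesis A_tail : tail A.
Hypothesis E_tail : tail E.
Hypothesis B_tail : tail B.
Hypothesis D_bound : forall n w s, (0 < n)%N ->
  A n w < s -> E n w < s -> B n w < s -> 8 * eps + (c + 3) * s < alpha ->
  mu * D n w < 8 * eps + (c + 3) * s.

Let measurable_ge (F : W -> R) (r : R) : measurable_fun setT F ->
  measurable [set w | r <= F w].
Proof.
move=> mF; have := mF measurableT `[r, +oo[%classic (measurable_itv _).
by rewrite setTI; congr measurable; apply/seteqP; split=> w /=; rewrite in_itv/= andbT.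
Qed.

Let measurable_lt (F : W -> R) (r : R) : measurable_fun setT F ->
  measurable [set w | F w < r].
Proof.
move=> mF; rewrite (_ : [set w | F w < r] = ~` [set w | r <= F w]).
  by apply: measurableC; exact: measurable_ge.
by apply/seteqP; split=> w /=; rewrite ltNge => /negP.
Qed.

Lemma estimator_tail (n : nat) (t s : R) : (0 < n)%N -> 0 <= t ->
  s = (Num.sqrt n%:R)^-1 * (1 + t) -> 8 * eps + (c + 3) * s < alpha ->
  ((1 - 3 * expR (- (t ^+ 2 / 2)))%:E <=
   Pr [set w | (D n w < (8 * eps + (c + 3) * s) / mu)%R])%E.
Proof.
move=> n0 t0 sE sa.
apply: (union_bound3 (measurable_ge s (A_meas n)) (measurable_ge s (E_meas n))
  (measurable_ge s (B_meas n))).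
- exact/measurable_lt/D_meas.
- by rewrite sE; exact: A_tail.
- by rewrite sE; exact: E_tail.
- by rewrite sE; exact: B_tail.
- move=> w /= /not_orP[/not_orP[/negP + /negP +] /negP +].
  rewrite -!ltNge => As Es Bs.
  by rewrite ltr_pdivlMr// mulrC; exact: D_bound.
Qed.

Lemma estimator_limsup : 0 <= eps ->
  Pr [set w | (limn_esup (fun n => (D n w)%:E) <= (8 * eps / mu)%:E)%E] = 1%E.
Proof.
move=> eps0; apply: limn_esup_le_prob1 => // delta delta0.
have c3 : 0 < c + 3 by rewrite ltr_wpDl.
(* Any [s <= 2 * rho] satisfies [(c + 3) * s <= delta * mu], as the claim demands, and
   [(c + 3) * s <= alpha / 2], which keeps the excess below [alpha]. *)
pose rho := Num.min (delta * mu) (alpha / 2) / (2 * (c + 3)).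
have min0 : 0 < Num.min (delta * mu) (alpha / 2).
  by rewrite lt_min mulr_gt0// divr_gt0.
have rho0 : 0 < rho by rewrite divr_gt0// mulr_gt0.
exists (Num.truncn (rho ^- 2)).+1, (rho ^+ 2 / 2); split.
  by rewrite divr_gt0// exprn_gt0.
move=> n Nn; have n0 : (0 < n)%N by exact: leq_trans Nn.
have n0R : 0 < n%:R :> R by rewrite ltr0n.
have sn0 : 0 < Num.sqrt n%:R :> R by rewrite sqrtr_gt0.
have nrho : rho ^- 2 <= n%:R.
  by apply: le_trans (ltW (truncnS_gt _)) _; rewrite ler_nat.
have srho : (Num.sqrt n%:R)^-1 <= rho.
  rewrite -[leRHS]invrK lef_pV2 ?posrE ?invr_gt0//.
  rewrite -ler_sqr ?nnegrE ?invr_ge0 ?(ltW rho0) ?(ltW sn0)//.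
  by rewrite sqr_sqrtr ?(ltW n0R)// exprVn.
(* With [t] proportional to sqrt n, [s] is at most [2 * rho] while the tail exponent is linear in
   [n]. *)
pose t := rho * Num.sqrt n%:R.
have t0 : 0 <= t by rewrite mulr_ge0// ltW.
pose s := (Num.sqrt n%:R)^-1 * (1 + t).
have sE : s = (Num.sqrt n%:R)^-1 + rho.
  by rewrite /s /t mulrDr mulr1 mulrCA mulVf ?mulr1// gt_eqF.
have cs : (c + 3) * s <= Num.min (delta * mu) (alpha / 2).
  have -> : Num.min (delta * mu) (alpha / 2) = (c + 3) * (rho + rho).
    rewrite /rho; move: (Num.min _ _) => m; by field; rewrite gt_eqF.
  by rewrite ler_pM2l// sE lerD2r.
have csa : (c + 3) * s <= alpha / 2 by apply: le_trans cs _; rewrite ge_min lexx orbT.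
have csd : (c + 3) * s <= delta * mu by apply: le_trans cs _; rewrite ge_min lexx.
have sa : 8 * eps + (c + 3) * s < alpha.
  by move: csa eps_lt alpha_gt0; move: ((c + 3) * s) => v; lra.
have := estimator_tail n0 t0 erefl sa; rewrite -/s.
set G := (X in Pr X) => hG.
have mG : measurable G by exact/measurable_lt/D_meas.
have mS : measurable [set w | 8 * eps / mu + delta <= D n w] by exact/measurable_ge/D_meas.
apply: (@le_trans _ _ (Pr (~` G))).
  apply: le_measure; rewrite ?inE//; first exact: measurableC.
  move=> w /= h; apply/negP; rewrite -leNgt; apply: le_trans h.
  by rewrite mulrDl lerD2l ler_pdivrMr.
rewrite probability_setC//.
have PG : Pr G \is a fin_num by exact: fin_num_measure.
move: hG; rewrite -(fineK PG) -EFinB !lee_fin.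
have -> : t ^+ 2 / 2 = rho ^+ 2 / 2 * n%:R.
  by rewrite /t exprMn sqr_sqrtr ?(ltW n0R)//; ring.
have := expR_ge0 (- (rho ^+ 2 / 2 * n%:R)).
by move: (expR _) (fine _) => x y; lra.
Qed.

(** [t] is chosen so that exp (- t^2 / 2) = eta / 8, and three tails cost only 3 eta / 8. The lower
    bound on [n] yields [h1] and the lower bound on [eta] yields [h2]. *)
Lemma estimator_quantile (n : nat) (eta : R) :
  16 * (c + 3) ^+ 2 / alpha ^+ 2 <= n%:R ->
  8 * expR (- (alpha ^+ 2 / (32 * (c + 3) ^+ 2) * n%:R)) <= eta -> eta < 1 ->
  ((1 - eta)%:E <= Pr [set w | (D n w < 8 * eps / mu +
     (Num.sqrt n%:R)^-1 * (c + 3) * ((1 + Num.sqrt (2 * ln (8 / eta))) / mu))%R])%E.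
Proof.
move=> nC etaC eta1.
have c3 : 0 < c + 3 by rewrite ltr_wpDl.
have a2 : 0 < alpha ^+ 2 by rewrite exprn_gt0.
have n0R : 0 < n%:R :> R.
  by apply: lt_le_trans nC; rewrite divr_gt0// mulr_gt0// exprn_gt0.
have n0 : (0 < n)%N by rewrite ltr0n in n0R.
have eta0 : 0 < eta by apply: lt_le_trans etaC; rewrite mulr_gt0// expR_gt0.
have sn0 : 0 < Num.sqrt n%:R :> R by rewrite sqrtr_gt0.
set l := ln (8 / eta).
have le0 : 0 < 8 / eta by rewrite divr_gt0.
have l0 : 0 <= l by rewrite ln_ge0// ler_pdivlMr// mul1r; lra.
have el : expR (- l) = eta / 8 by rewrite expRN lnK// invf_div.
have lC : l <= alpha ^+ 2 / (32 * (c + 3) ^+ 2) * n%:R.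
  rewrite -lerN2 -ler_expR el ler_pdivlMr// mulrC; exact: etaC.
pose t := Num.sqrt (2 * l); have t0 : 0 <= t by exact: sqrtr_ge0.
have tE : t ^+ 2 / 2 = l by rewrite sqr_sqrtr ?mulr_ge0// mulrC mulrA mulVf// mul1r.
pose s := (Num.sqrt n%:R)^-1 * (1 + t).
have a16 : (alpha / 4) ^+ 2 = alpha ^+ 2 / 16 by field.
have h1 : (c + 3) * (Num.sqrt n%:R)^-1 <= alpha / 4.
  rewrite ler_pdivrMr// -ler_sqr ?nnegrE ?mulr_ge0 ?divr_ge0
    ?(ltW c3) ?(ltW sn0) ?(ltW alpha_gt0)//.
  rewrite exprMn sqr_sqrtr ?(ltW n0R)// a16.
  by move: nC; rewrite ler_pdivrMr//; move: (alpha ^+ 2) ((c + 3) ^+ 2) => x y; lra.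
have h2 : (c + 3) * ((Num.sqrt n%:R)^-1 * t) <= alpha / 4.
  rewrite mulrCA mulrC ler_pdivrMr// -ler_sqr ?nnegrE ?mulr_ge0 ?divr_ge0
    ?(ltW c3) ?(ltW sn0) ?(ltW alpha_gt0)//.
  rewrite !exprMn (sqr_sqrtr (ltW n0R)) sqr_sqrtr ?mulr_ge0// -exprMn a16.
  have c32 : 0 < 32 * (c + 3) ^+ 2 by rewrite mulr_gt0// exprn_gt0.
  move: lC; rewrite mulrAC ler_pdivlMr//.
  by move: (alpha ^+ 2) ((c + 3) ^+ 2) => x y; lra.
have sa : 8 * eps + (c + 3) * s < alpha.
  rewrite /s mulrDr mulr1 mulrDr; move: h1 h2 eps_lt alpha_gt0.
  by move: ((c + 3) * (Num.sqrt n%:R)^-1) ((c + 3) * ((Num.sqrt n%:R)^-1 * t)) => x y; lra.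
have -> : 8 * eps / mu + (Num.sqrt n%:R)^-1 * (c + 3) * ((1 + Num.sqrt (2 * l)) / mu) =
    (8 * eps + (c + 3) * s) / mu by rewrite /s -/t; ring.
apply: le_trans (estimator_tail n0 t0 erefl sa).
by rewrite tE el lee_fin; lra.
Qed.

End tail_bounds.

(** * Consequences of the hypotheses, and the assembly *)

Lemma rkhs_is_kernel (R : realType) (T : Type) (k : T -> T -> R) (H : @rkhs R T k) :
  is_kernel k.
Proof.
apply/is_kernelP; split=> [x y|s]; first by rewrite -!(inner_feature H) innerC.
have -> : k = (fun x y => inner H (feature H x) (feature H y)).
  by apply/funext => x; apply/funext => y; rewrite inner_feature.
by rewrite kform_inner sqr_ge0.
Qed.

Lemma rkhs_subsingleton (R : realType) (T : Type) (k : T -> T -> R)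
    (H : @rkhs R T k) (f g : H) : (forall x, k x x = 0) -> f = g.
Proof.
move=> k0; apply: rkhs_eval_inj; apply/funext => x.
have phi0 : feature H x = 0.
  by apply/eqP; rewrite -normr_eq0 -sqrf_eq0 norm_inner inner_feature k0.
by rewrite -!reproducing phi0 innerC inner0l innerC inner0l.
Qed.

Lemma op_norm_bound (R : realType) (V W : normedModType R) (C : {linear V -> W})
    (c : R) (f : V) : (op_norm C <= c%:E)%E -> `|C f| <= c * `|f|.
Proof.
move=> Cc; have [->|f0] := eqVneq f 0; first by rewrite linear0 !normr0 mulr0.
have nf : 0 < `|f| by rewrite normr_gt0.
rewrite mulrC -ler_pdivrMl//.
have -> : `|f|^-1 * `|C f| = `|C (`|f|^-1 *: f)|.
  by rewrite linearZ normrZ ger0_norm// invr_ge0.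
rewrite -lee_fin; apply: le_trans Cc.
apply: ereal_sup_ubound; exists (`|f|^-1 *: f) => //=.
by rewrite normrZ ger0_norm ?invr_ge0// mulVf// gt_eqF.
Qed.

Lemma op_norm_ge0 (R : realType) (V W : normedModType R) (C : {linear V -> W}) :
  (0 <= op_norm C)%E.
Proof.
apply: ereal_sup_ubound; exists 0 => /=; first by rewrite normr0.
by rewrite linear0 normr0.
Qed.

Lemma bmeas2_tensorl (R : realType) d1 d2 (X : measurableType d1)
    (Y : measurableType d2) (kX : X -> X -> R) (kY : Y -> Y -> R) y y' :
  bmeas2 (tensor_kernel kX kY) -> kY y y' != 0 -> bmeas2 kX.
Proof.
move=> bk kYn0.
have : bmeas (fun q : X * X => (kY y y')^-1 * tensor_kernel kX kY (q.1, y) (q.2, y')).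
  apply: bmeasZ; apply: (bmeas2_comp (u := fun q : X * X => (q.1, y)) (v := fun q => (q.2, y')))
    => //.
  - by apply: measurable_fun_pair => //; exact: measurable_fst.
  - by apply: measurable_fun_pair => //; exact: measurable_snd.
congr bmeas; apply/funext => q.
by rewrite /tensor_kernel/= mulrCA mulVf// mulr1.
Qed.

Lemma bmeas2_tensorr (R : realType) d1 d2 (X : measurableType d1)
    (Y : measurableType d2) (kX : X -> X -> R) (kY : Y -> Y -> R) x x' :
  bmeas2 (tensor_kernel kX kY) -> kX x x' != 0 -> bmeas2 kY.
Proof.
move=> bk kXn0.
have : bmeas (fun q : Y * Y => (kX x x')^-1 * tensor_kernel kX kY (x, q.1) (x', q.2)).
  apply: bmeasZ; apply: (bmeas2_comp (u := fun q : Y * Y => (x, q.1)) (v := fun q => (x', q.2)))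
    => //.
  - by apply: measurable_fun_pair => //; exact: measurable_fst.
  - by apply: measurable_fun_pair => //; exact: measurable_snd.
congr bmeas; apply/funext => q.
by rewrite /tensor_kernel/= mulKf.
Qed.

Lemma borel_measurable_comp (R : realType) d (W : measurableType d)
    (T : topologicalType) (f : W -> T) (h : T -> R) :
  borel_measurable f -> continuous h -> measurable_fun setT (h \o f).
Proof.
move=> mf /continuousP hc.
apply: (measurability _ (RGenOpens.measurableE R)) => _ [_ [a [b ->] <-]].
rewrite setTI comp_preimage; apply: mf; apply: sub_sigma_algebra.
by apply: hc; exact: interval_open.
Qed.

Lemma measurable_euclidean_dist (R : realType) d (W : measurableType d) (p : nat)
    (Theta : set 'rV[R]_p) (th : W -> Theta) (v : 'rV[R]_p) :
  borel_measurable th ->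
  measurable_fun setT (fun w => euclidean_norm (\val (th w) - v)).
Proof.
move=> mth; apply: (measurableT_comp (continuous_measurable_fun (@sqrt_continuous R))).
apply: measurable_sum => i; apply: measurable_funX.
rewrite (_ : (fun w => _) = (fun w => \val (th w) 0 i - v 0 i)); last first.
  by apply/funext => w; rewrite !mxE.
apply: measurable_funB; last exact: measurable_cst.
apply: (borel_measurable_comp (h := fun t : Theta => \val t 0 i)) => //.
move=> t; apply: (@continuous_comp _ _ _ (set_val : Theta -> _) (fun u : 'rV[R]_p => u 0 i)).
  exact: initial_continuous.
exact: coord_continuous.
Qed.

Lemma iid_fst (R : realType) d d1 d2 (W : measurableType d)
    (X : measurableType d1) (Y : measurableType d2) (Pr : probability W R)
    (P : probability (X * Y)%type R) (V : nat -> W -> X * Y) :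
  iid_from Pr P V ->
  iid_from Pr (distribution P (@fst X Y)) (fun i w => (V i w).1).
Proof.
move=> [mV PV ind]; split.
- by move=> i; exact: (measurableT_comp measurable_fst (mV i)).
- move=> i A mA; apply: (PV i (fst @^-1` A)).
  by rewrite -[X in measurable X]setTI; exact: measurable_fst.
- move=> J A mA; apply: (ind J (fun i => fst @^-1` A i)) => i.
  by rewrite -[X in measurable X]setTI; exact: measurable_fst.
Qed.

Theorem theorem3 (R : realType) (alpha frakC : R)
    (alpha_gt0 : 0 < alpha) (alpha_le2 : alpha <= 2) :
  exists C1 C2 : R, [/\ 0 < C1, 0 < C2 &
  forall
    (* spaces, kernels and their RKHSs *)
    (X Y : ptopologicalType)
    (kX : X -> X -> R) (kY : Y -> Y -> R)
    (kX_kernel : is_kernel kX) (kY_kernel : is_kernel kY)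
    (kX_cont : continuous (fun q : X * X => kX q.1 q.2))
    (kY_cont : continuous (fun q : Y * Y => kY q.1 q.2))
    (kX_le1 : forall x x', `|kX x x'| <= 1)
    (kY_le1 : forall y y', `|kY y y'| <= 1)
    (k_meas : measurable_fun
       [set: (borel X * borel Y) * (borel X * borel Y)]
       (fun q => tensor_kernel kX kY q.1 q.2 : R))
    (k_le1 : forall z z', `|tensor_kernel kX kY z z'| <= 1)
    (HX : @rkhs R (borel X) kX) (HY : @rkhs R (borel Y) kY)
    (H : @rkhs R (borel X * borel Y)%type (tensor_kernel kX kY))
    (* model *)
    (Lam : Type) (Pfam : Lam -> probability (borel Y) R)
    (p : nat) (Theta : set 'rV[R]_p)
    (Theta_polish : polish R (set_type Theta))
    (g : Theta -> X -> Lam)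
    (g_meas : forall (theta : Theta) (A : set (borel Y)), measurable A ->
       measurable_fun [set: borel X]
         (fun x => Pfam (g theta x) A : \bar R))
    (P0 : probability (borel X * borel Y)%type R)
    (P0X := distribution P0 (@fst (borel X) (borel Y))
       : probability (borel X) R)
    (Pth := fun theta : Theta => joint P0X (g_meas theta)
       : probability (borel X * borel Y)%type R)
    (* conditional mean embedding operators *)
    (C : Theta -> {linear HX -> HY})
    (C_cme : forall theta : Theta,
       is_cme (fun x => Pfam (g theta x)) (C theta))
    (C_bounded : forall theta : Theta, (op_norm (C theta) < +oo)%E)
    (C_sup : ereal_sup (range (fun theta : Theta => op_norm (C theta)))
       = frakC%:E)
    (* identification *)
    (dist := fun theta theta' : Theta =>
       euclidean_norm (\val theta - \val theta'))
    (Dk := fun theta : Theta => mmd H (Pth theta) P0)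
    (theta0 : Theta)
    (theta0_min : (Dk theta0)%:E = ereal_inf (range (fun t => (Dk t)%:E)))
    (theta0_uniq : forall theta : Theta,
       (Dk theta)%:E = ereal_inf (range (fun t => (Dk t)%:E)) ->
       theta = theta0)
    (U : set Theta) (U_nbhs : nbhs theta0 U)
    (mu : R) (mu_gt0 : 0 < mu)
    (sharp : forall theta : Theta, U theta ->
       Dk theta0 + mu * dist theta theta0 <= Dk theta)
    (alphaE : alpha%:E =
       (ereal_inf [set (Dk theta)%:E | theta in ~` U] - (Dk theta0)%:E)%E)
    (* data and estimator *)
    (d : measure_display) (W : measurableType d) (Pr : probability W R)
    (data0 : nat -> W -> borel X * borel Y)
    (data0_iid : iid_from Pr P0 data0)
    (data : nat -> nat -> W -> borel X * borel Y)
    (data_meas : forall n i, measurable_fun setT (data n i))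
    (eps : R) (eps_ge0 : 0 <= eps) (eps_lt : eps < alpha / 64)
    (contam : forall n : nat, (0 < n)%N -> forall w : W,
       adversarial_contamination eps n
         (fun i => data n i w) (fun i => data0 i w))
    (thetahat : nat -> W -> Theta)
    (thetahat_meas : forall n : nat, (0 < n)%N -> borel_measurable (thetahat n))
    (thetahat_argmin : forall n : nat, (0 < n)%N -> forall w : W,
       is_argmin
         (fun theta : Theta =>
            mmd H
              (empirical_model (fun x : borel X => Pfam (g theta x)) n
                 (fun i => (data n i w).1))
              (empirical R n (fun i => data n i w)) ^+ 2)
         (thetahat n w)),
    Pr [set w | (limn_esup (fun n => (dist (thetahat n w) theta0)%:E)
                 <= (8 * eps / mu)%R%:E)%E] = 1%E
    /\
    (forall (n : nat) (eta : R), C1 <= n%:R ->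
       8 * expR (- (C2 * n%:R)) <= eta -> eta < 1 ->
       ((1 - eta)%R%:E <=
        Pr [set w | (dist (thetahat n w) theta0 <
                     8 * eps / mu +
                     (Num.sqrt n%:R)^-1 * (frakC + 3) *
                     ((1 + Num.sqrt (2 * ln (8 / eta))) / mu))%R])%E)].
Proof.
(* The constants are fixed before the operators are given, when the sign of [frakC] is still
   unknown; [C_sup] later shows that it is nonnegative. *)
pose K := `|frakC| + 3.
have K0 : 0 < K by rewrite ltr_wpDl.
exists (16 * K ^+ 2 / alpha ^+ 2), (alpha ^+ 2 / (32 * K ^+ 2)); split.
- by rewrite divr_gt0 ?mulr_gt0 ?exprn_gt0.
- by rewrite divr_gt0 ?mulr_gt0 ?exprn_gt0.
move=> X Y kX kY kX_kernel kY_kernel _ _ kX_le1 kY_le1 k_meas k_le1 HX HY H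
  Lam Pfam p Theta _ g g_meas P0 P0X Pth C C_cme _ C_sup dist Dk theta0 _ _
  U _ mu mu_gt0 sharp alphaE d W Pr data0 data0_iid data _ eps eps_ge0 eps_lt
  contam thetahat thetahat_meas thetahat_argmin.
have bk : bmeas2 (tensor_kernel kX kY : borel X * borel Y -> _) by split => //; exists 1.
have [data0_meas _ _] := data0_iid.
have outside theta : ~ U theta -> alpha <= Dk theta - Dk theta0.
  move=> nU; rewrite -lee_fin alphaE EFinB; apply: leeB => //.
  by apply: ereal_inf_lbound; exists theta.
(* If k vanishes on the diagonal then all mean embeddings coincide and alpha
   would be 0 or +oo. Otherwise dividing k by a nonzero value of one factor shows
   that the other one is measurable. *)
have [[x [x' kXn0]] [y [y' kYn0]]] :
    (exists x x', kX x x' != 0) /\ (exists y y', kY y y' != 0).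
  apply: contrapT => k0.
  have kz0 z : tensor_kernel kX kY z z = 0.
    apply/eqP; rewrite mulf_eq0; apply: contrapT => /negP.
    rewrite negb_or => /andP[kX0 kY0]; apply: k0.
    by split; [exists z.1, z.1|exists z.2, z.2].
  have Dk0 theta : Dk theta = 0.
    rewrite /Dk /mmd (rkhs_subsingleton (mean_embedding H P0)
      (mean_embedding H (Pth theta)) kz0).
    by rewrite subrr normr0.
  have [[theta nU]|allU] := pselect (exists theta, ~ U theta).
    by have := outside theta nU; rewrite !Dk0 subrr leNgt alpha_gt0.
  have U0 : [set (Dk theta)%:E | theta in ~` U] = set0.
    by apply/seteqP; split=> // z [theta nU _]; apply: allU; exists theta.
  by move: alphaE; rewrite U0 ereal_inf0.
have kX_bmeas : bmeas2 (kX : borel X -> _) by exact: bmeas2_tensorl bk kYn0.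
have kY_bmeas : bmeas2 (kY : borel Y -> _) by exact: bmeas2_tensorr bk kXn0.
have C_op theta : (op_norm (C theta) <= frakC%:E)%E.
  by rewrite -C_sup; apply: ereal_sup_ubound; exists theta.
have frakC0 : 0 <= frakC.
  by rewrite -lee_fin; apply: le_trans (C_op theta0); exact: op_norm_ge0.
have KE : K = frakC + 3 by rewrite /K ger0_norm.
pose Q theta (x : borel X) : probability (borel Y) R := Pfam (g theta x).
pose x0 w i : borel X := (data0 i w).1.
pose A n w := discrepancy P0X (fun x y => kX x y * kX x y) n (x0 w).
pose E n w := discrepancy P0X
  (fibre_kernel (kX : borel X -> borel X -> R) HY (Q theta0)) n (x0 w).
pose B n w := discrepancy P0 (tensor_kernel kX kY : borel X * borel Y -> _) n (data0 ^~ w).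
pose D n w := dist (thetahat n w) theta0.
have x0_meas i : measurable_fun setT (fun w => x0 w i).
  exact: (measurableT_comp measurable_fst (data0_meas i)).
have x0_iid : iid_from Pr P0X (fun i w => x0 w i) by exact: iid_fst.
have kXX : is_kernel (fun x y : borel X => kX x y * kX x y) by exact: schur_product.
have kXX_bmeas : bmeas2 (fun x y : borel X => kX x y * kX x y) by exact: bmeasM.
have kXX1 x1 x2 : `|kX x1 x2 * kX x1 x2| <= 1 by rewrite normrM mulr_ile1.
have G := fibre_kernel_is_kernel HX HY H kX_bmeas kY_bmeas kX_le1 kY_le1 (Q theta0).
have G_bmeas := bmeas2_fibre_kernel HY kX_bmeas kY_bmeas kY_le1 (g_meas theta0).
have G1 := fibre_kernel_le1 HX HY H kX_bmeas kY_bmeas kX_le1 kY_le1 (Q theta0).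
have tensor_ker : is_kernel (tensor_kernel kX kY : borel X * borel Y -> _)
  by exact: rkhs_is_kernel H.
have A_meas n : measurable_fun setT (A n) by exact: measurable_discrepancy.
have E_meas n : measurable_fun setT (E n) by exact: measurable_discrepancy.
have B_meas n : measurable_fun setT (B n) by exact: measurable_discrepancy.
have D_meas n : (0 < n)%N -> measurable_fun setT (D n).
  by move=> n0; apply: measurable_euclidean_dist; exact: thetahat_meas.
have D_bound n w s : (0 < n)%N -> A n w < s -> E n w < s -> B n w < s ->
    8 * eps + (frakC + 3) * s < alpha -> mu * D n w < 8 * eps + (frakC + 3) * s.
  move=> n0 As Es Bs sa.
  have excess : Dk (thetahat n w) - Dk theta0 < 8 * eps + (frakC + 3) * s.
    have C_le theta f := op_norm_bound f (C_op theta).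
    have h := (mmd_excess_le (H := H) (Q := Q) kX_kernel kX_bmeas kY_bmeas
      kX_le1 kY_le1 g_meas frakC0 C_le C_cme P0 P0X theta0 n0 (contam n n0 w)
      (thetahat_argmin n n0 w)).
    apply: le_lt_trans h _.
    rewrite -/(A n w) -/(E n w) -/(B n w).
    have cA : frakC * A n w <= frakC * s := ler_wpM2l frakC0 (ltW As).
    move: cA Es Bs; rewrite [(_ + 3) * s]mulrDl.
    by move: (frakC * A n w) (frakC * s) (E n w) (B n w) => a u e b; lra.
  have Uhat : U (thetahat n w).
    apply: contrapT => /outside; rewrite leNgt => /negP; apply.
    exact: lt_trans excess sa.
  apply: le_lt_trans excess.
  by rewrite lerBrDl; exact: sharp.
have A_tail n t (n0 : (0 < n)%N) (t0 : 0 <= t) :=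
  discrepancy_concentration kXX kXX_bmeas x0_iid kXX1 n0 t0.
have E_tail n t (n0 : (0 < n)%N) (t0 : 0 <= t) :=
  discrepancy_concentration G G_bmeas x0_iid G1 n0 t0.
have B_tail n t (n0 : (0 < n)%N) (t0 : 0 <= t) :=
  discrepancy_concentration tensor_ker bk data0_iid k_le1 n0 t0.
split.
  exact (estimator_limsup alpha_gt0 frakC0 mu_gt0 eps_lt A_meas E_meas B_meas
    D_meas A_tail E_tail B_tail D_bound eps_ge0).
move=> n eta; rewrite KE => nC etaC eta1.
exact (estimator_quantile alpha_gt0 frakC0 mu_gt0 eps_lt A_meas E_meas B_meas
  D_meas A_tail E_tail B_tail D_bound nC etaC eta1).
Qed.
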